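(* Let $H$ and $K$ be Hilbert $\mathfrak{A}$-modules over a $C^*$-algebra $\mathfrak{A}$, let $M\in\mathcal{L}(K)$ and $N\in\mathcal{L}(H)$ be weights, and let $A\in\mathcal{L}(H,K)$. Then the following statements are equivalent: (i) $A^\dag_{MN}$ exists; (ii) $A^\dag_{M I_H}$ and $A^\dag_{I_K N}$ both exist; (iii) $A^\dag$ exists, and the operators $R_{A,N}=A^\dag A+(I_H-A^\dag A)N$ and $L_{A,M^{-1}}=AA^\dag+M^{-1}(I_K-AA^\dag)$ are invertible in $\mathcal{L}(H)$ and $\mathcal{L}(K)$, respectively. In each case, $$A^\dag_{MN}=R_{A,N}^{-1}\cdot A^\dag\cdot L_{A,M^{-1}}^{-1}.$$
   Context: $\mathcal{L}(H,K)$ is the set of adjointable operators from $H$ to $K$, $\mathcal{L}(H)=\mathcal{L}(H,H)$, and $I_H$ is the identity operator on $H$. A weight on $K$ is an operator $M\in\mathcal{L}(K)$ with $M=M^*$ that is invertible in $\mathcal{L}(K)$ (it need not be positive). For weights $M\in\mathcal{L}(K)$, $N\in\mathcal{L}(H)$ and $A\in\mathcal{L}(H,K)$, the weighted Moore-Penrose inverse $A^\dag_{MN}$ (if it exists) is the (necessarily unique) element $X\in\mathcal{L}(K,H)$ satisfying $AXA=A$, $XAX=X$, $(MAX)^*=MAX$, $(NXA)^*=NXA$. The Moore-Penrose inverse is $A^\dag=A^\dag_{I_K I_H}$. *)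

(* Defs.v *)
From HB Require Import structures.
From mathcomp Require Import all_boot all_order all_algebra.
From mathcomp Require Import all_classical all_reals all_analysis.
From mathcomp Require Import complex.

Set Implicit Arguments.
Unset Strict Implicit.
Unset Printing Implicit Defensive.

Import Order.TTheory GRing.Theory Num.Theory.
Import numFieldNormedType.Exports.

Local Open Scope classical_set_scope.
Local Open Scope ring_scope.

(* C*-algebras over the complex field R[i]; no unit is required, which is why
   the product is not taken from a MathComp ring structure. *)
HB.mixin Record CompleteNormedModule_isCstarAlgebra (R : realType) A
    & CompleteNormedModule R[i] A := {
  cmul : A -> A -> A;
  cstar : A -> A;
  cmulA : associative cmul;
  cmulDl : left_distributive cmul +%R;
  cmulDr : right_distributive cmul +%R;
  cmulZl : forall (z : R[i]) (a b : A), cmul (z *: a) b = z *: cmul a b;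
  cmulZr : forall (z : R[i]) (a b : A), cmul a (z *: b) = z *: cmul a b;
  cmul_norm : forall a b : A, `|cmul a b| <= `|a| * `|b|;
  cstarK : involutive cstar;
  cstarD : forall a b : A, cstar (a + b) = cstar a + cstar b;
  cstarZ : forall (z : R[i]) (a : A), cstar (z *: a) = z^* *: cstar a;
  cstarM : forall a b : A, cstar (cmul a b) = cmul (cstar b) (cstar a);
  cstar_norm : forall a : A, `|cmul (cstar a) a| = `|a| ^+ 2
}.

#[short(type="cstarAlgType")]
HB.structure Definition CstarAlgebra (R : realType) :=
  {A of CompleteNormedModule R[i] A & CompleteNormedModule_isCstarAlgebra R A}.

(* The product (z, a)(w, b) = (zw, zb + wa + ab) of the unitization of A, whose
   unit is (1, 0); the spectrum of a is taken in the unitization. *)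
Definition unitization_mul (R : realType) (A : cstarAlgType R)
    (x y : R[i] * A) : R[i] * A :=
  (x.1 * y.1, x.1 *: y.2 + y.1 *: x.2 + cmul x.2 y.2).

Definition spectrum (R : realType) (A : cstarAlgType R) (a : A) : set R[i] :=
  [set z | ~ exists y : R[i] * A,
     unitization_mul (z, - a) y = (1, 0) /\
     unitization_mul y (z, - a) = (1, 0)].

(* In R[i], 0 <= z means that z is a nonnegative real number. *)
Definition cpositive (R : realType) (A : cstarAlgType R) (a : A) : Prop :=
  cstar a = a /\ forall z, spectrum a z -> 0 <= z.

(* Right Hilbert modules, with inner product linear in the second variable.
   The norm |x| = |<x, x>|^(1/2) is carried by the normed module structure, so
   that completeness is that of CompleteNormedModule. *)
HB.mixin Record CompleteNormedModule_isHilbertModule (R : realType)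
    (A : cstarAlgType R) H & CompleteNormedModule R[i] H := {
  hact : H -> A -> H;
  inner : H -> H -> A;
  hactDl : forall (x y : H) (a : A), hact (x + y) a = hact x a + hact y a;
  hactDr : forall (x : H) (a b : A), hact x (a + b) = hact x a + hact x b;
  hactM : forall (x : H) (a b : A), hact x (cmul a b) = hact (hact x a) b;
  hactZl : forall (z : R[i]) (x : H) (a : A), hact (z *: x) a = z *: hact x a;
  hactZr : forall (z : R[i]) (x : H) (a : A), hact x (z *: a) = z *: hact x a;
  innerDr : forall x y y' : H, inner x (y + y') = inner x y + inner x y';
  innerZr : forall (z : R[i]) (x y : H), inner x (z *: y) = z *: inner x y;
  inner_hact : forall (x y : H) (a : A), inner x (hact y a) = cmul (inner x y) a;
  inner_star : forall x y : H, inner y x = cstar (inner x y);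
  inner_pos : forall x : H, cpositive (inner x x);
  inner_def : forall x : H, inner x x = 0 -> x = 0;
  inner_norm : forall x : H, `|x| ^+ 2 = `|inner x x|
}.

#[short(type="hilbertModType")]
HB.structure Definition HilbertModule (R : realType) (A : cstarAlgType R) :=
  {H of CompleteNormedModule R[i] H & CompleteNormedModule_isHilbertModule R A H}.

(* An adjointable operator is stored together with its adjoint, which it
   determines (adjointable_ext); linearity and boundedness are consequences. *)
Record adjointable (R : realType) (A : cstarAlgType R) (H K : hilbertModType A)
    := Adjointable {
  aop :> H -> K;
  aadj : K -> H;
  aadjP : forall x y, inner (aop x) y = inner x (aadj y) :> A
}.

Notation "''L' ( H , K )" := (adjointable H K)
  (at level 8, format "''L' ( H ,  K )") : type_scope.
Notation "''L' ( H )" := (adjointable H H)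
  (at level 8, format "''L' ( H )") : type_scope.

Section InnerTheory.
Context (R : realType) (A : cstarAlgType R) (H : hilbertModType A).
Implicit Types x y : H.

Lemma innerDl x x' y : inner (x + x') y = inner x y + inner x' y :> A.
Proof. by rewrite inner_star innerDr cstarD -!inner_star. Qed.

Lemma inner0r x : inner x 0 = 0 :> A.
Proof. by rewrite -(scale0r (0 : H)) innerZr scale0r. Qed.

Lemma inner0l x : inner 0 x = 0 :> A.
Proof. by apply: (addrI (inner 0 x)); rewrite -innerDl !addr0. Qed.

Lemma innerNr x y : inner x (- y) = - inner x y :> A.
Proof. by rewrite -scaleN1r innerZr scaleN1r. Qed.

Lemma innerNl x y : inner (- x) y = - inner x y :> A.
Proof. by apply: (addrI (inner x y)); rewrite -innerDl !subrr inner0l. Qed.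

Lemma inner_inj x x' : (forall y, inner y x = inner y x' :> A) -> x = x'.
Proof.
move=> xx'; apply/subr0_eq; apply: (@inner_def R A).
by rewrite innerDr innerNr xx' subrr.
Qed.

End InnerTheory.

Section Operators.
Context (R : realType) (A : cstarAlgType R).
Implicit Types H K G : hilbertModType A.

Lemma adjointable_ext H K (S T : 'L(H, K)) : S =1 T -> S = T.
Proof.
case: S T => [s s' sP] [t t' tP] /= /funext st; subst t.
have st' : s' = t' by apply/funext => y; apply: inner_inj => x; rewrite -sP tP.
by subst t'; congr Adjointable; apply: Prop_irrelevance.
Qed.

Definition adjoint H K (T : 'L(H, K)) : 'L(K, H).
Proof.
by exists (aadj T) T => x y; rewrite inner_star -aadjP -inner_star.
Defined.

Definition idop H : 'L(H) :=
  @Adjointable R A H H id id (fun x y => erefl).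

Definition ocomp H K G (S : 'L(K, G)) (T : 'L(H, K)) : 'L(H, G).
Proof.
by exists (S \o T) (aadj T \o aadj S) => x y; rewrite /= !aadjP.
Defined.

Definition ozero H K : 'L(H, K).
Proof. by exists (fun=> 0) (fun=> 0) => x y; rewrite inner0l inner0r. Defined.

Definition oopp H K (T : 'L(H, K)) : 'L(H, K).
Proof.
by exists (fun x => - T x) (fun y => - aadj T y) => x y;
  rewrite innerNl innerNr aadjP.
Defined.

Definition oadd H K (S T : 'L(H, K)) : 'L(H, K).
Proof.
by exists (fun x => S x + T x) (fun y => aadj S y + aadj T y) => x y;
  rewrite innerDl innerDr !aadjP.
Defined.

End Operators.

HB.instance Definition _ (R : realType) (A : cstarAlgType R)
  (H K : hilbertModType A) := gen_eqMixin 'L(H, K).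
HB.instance Definition _ (R : realType) (A : cstarAlgType R)
  (H K : hilbertModType A) := gen_choiceMixin 'L(H, K).

Section OperatorZmodule.
Context (R : realType) (A : cstarAlgType R) (H K : hilbertModType A).

Fact oaddA : associative (@oadd R A H K).
Proof. by move=> S T U; apply: adjointable_ext => x /=; rewrite addrA. Qed.

Fact oaddC : commutative (@oadd R A H K).
Proof. by move=> S T; apply: adjointable_ext => x /=; rewrite addrC. Qed.

Fact oadd0 : left_id (@ozero R A H K) (@oadd R A H K).
Proof. by move=> T; apply: adjointable_ext => x /=; rewrite add0r. Qed.

Fact oaddN : left_inverse (@ozero R A H K) (@oopp R A H K) (@oadd R A H K).
Proof. by move=> T; apply: adjointable_ext => x /=; rewrite addNr. Qed.

HB.instance Definition _ :=
  GRing.isZmodule.Build 'L(H, K) oaddA oaddC oadd0 oaddN.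

End OperatorZmodule.

Notation "S \oL T" := (ocomp S T)
  (at level 40, left associativity, format "S  \oL  T") : ring_scope.

Section WeightedMoorePenrose.
Context (R : realType) (A : cstarAlgType R).
Implicit Types H K : hilbertModType A.

Definition is_inverse H (T S : 'L(H)) : Prop :=
  S \oL T = idop H /\ T \oL S = idop H.

Definition invertible H (T : 'L(H)) : Prop := exists S, is_inverse T S.

(* Equal to 0 when T is not invertible. *)
Definition opinv H (T : 'L(H)) : 'L(H) := xget 0 [set S | is_inverse T S].

Definition weight H (M : 'L(H)) : Prop := adjoint M = M /\ invertible M.

Definition is_wmp H K (M : 'L(K)) (N : 'L(H)) (T : 'L(H, K)) (X : 'L(K, H)) :=
  [/\ T \oL X \oL T = T,
      X \oL T \oL X = X,
      adjoint (M \oL T \oL X) = M \oL T \oL X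
    & adjoint (N \oL X \oL T) = N \oL X \oL T].

Definition wmp_exists H K (M : 'L(K)) (N : 'L(H)) (T : 'L(H, K)) : Prop :=
  exists X, is_wmp M N T X.

(* The weighted Moore-Penrose inverse of T, or 0 when it does not exist. *)
Definition wmp H K (M : 'L(K)) (N : 'L(H)) (T : 'L(H, K)) : 'L(K, H) :=
  xget 0 [set X | is_wmp M N T X].

Definition mp_exists H K (T : 'L(H, K)) : Prop :=
  wmp_exists (idop K) (idop H) T.

Definition mp H K (T : 'L(H, K)) : 'L(K, H) := wmp (idop K) (idop H) T.

Definition Rop H K (T : 'L(H, K)) (N : 'L(H)) : 'L(H) :=
  mp T \oL T + (idop H - mp T \oL T) \oL N.

Definition Lop H K (T : 'L(H, K)) (B : 'L(K)) : 'L(K) :=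
  T \oL mp T + B \oL (idop K - T \oL mp T).

End WeightedMoorePenrose.

(* Main.v *)
(* (i) => (ii) needs, for an idempotent p of L(H), an orthogonal projection with the
   same kernel. It is p* p z^-1 with z = 1 + S* S and S = p - p*, so the point is that
   1 + S* S is invertible. This holds by the continuity method along 1 + t S* S, since
   |x|^2 <= |<x,x> + t <Sx,Sx>| and adjointable operators are bounded. The inequality
   |a| <= |a + b| for positive a, b follows from the spectral definition of positivity
   through square roots: if h is selfadjoint and h + s is invertible for all s > 0,
   then h + s is a square for large s, and being a square is locally constant in s.
   The other implications are algebra: for the idempotents P = A^+ A and E = Z A, with
   Z the inverse weighted by N, one has PE = P and EP = E, and the inverse of R_{A,N}
   is E + (1 - E) N^-1 (1 - P); the operator L is the adjoint of one of this shape. *)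

From HB Require Import structures.
From mathcomp Require Import all_boot all_order all_algebra.
From mathcomp Require Import all_classical all_reals all_analysis.
From mathcomp Require Import complex ring lra.
Require Import Defs.

Set Implicit Arguments.
Unset Strict Implicit.
Unset Printing Implicit Defensive.

Import Order.TTheory GRing.Theory Num.Theory.
Import numFieldNormedType.Exports.

Local Open Scope classical_set_scope.
Local Open Scope ring_scope.

(** * Norms with real values and fixed points *)

Section RealNorm.
Context (R : realType) (V : normedModType R[i]).
Implicit Types (x y : V) (z : R[i]).

(* The norm of a module over [R[i]] has values in [R[i]]. *)
Definition rnorm x : R := complex.Re `|x|.

Lemma rnormE x : `|x| = (rnorm x)%:C%C.
Proof. by rewrite RRe_real // ger0_real. Qed.

Lemma rnorm_ge0 x : 0 <= rnorm x.
Proof. by rewrite -ler0c -rnormE. Qed.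

Lemma rnorm0 : rnorm 0 = 0.
Proof. by rewrite /rnorm normr0. Qed.

Lemma rnorm_eq0 x : rnorm x = 0 -> x = 0.
Proof. by move=> x0; apply/eqP; rewrite -normr_eq0 rnormE x0. Qed.

Lemma rnormN x : rnorm (- x) = rnorm x.
Proof. by rewrite /rnorm normrN. Qed.

Lemma rnormD x y : rnorm (x + y) <= rnorm x + rnorm y.
Proof. by rewrite -lecR rmorphD /= -!rnormE ler_normD. Qed.

Lemma rnormB x y : rnorm (x - y) = rnorm (y - x).
Proof. by rewrite -rnormN opprB. Qed.

Lemma rnorm_dist x y t : rnorm (x - t) <= rnorm (x - y) + rnorm (y - t).
Proof. by apply: le_trans (rnormD _ _); rewrite addrA subrK. Qed.

Lemma rnormZ z x : rnorm (z *: x) = Normc.normc z * rnorm x.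
Proof.
apply: (@complexI R).
by rewrite -rnormE normrZ rnormE rmorphM /=.
Qed.

Lemma rnormZr (r : R) x : rnorm (r%:C%C *: x) = `|r| * rnorm x.
Proof. by rewrite rnormZ /= expr0n /= addr0 sqrtr_sqr. Qed.

End RealNorm.

(** * Geometric Cauchy sequences and the contraction principle on closed sets *)

Section Limits.
Context (R : realType) (V : completeNormedModType R[i]).

Lemma geometric_small (c q e : R) : 0 <= q < 1 -> 0 < e ->
  exists n, c * q ^+ n / (1 - q) < e.
Proof.
move=> /andP[q0 q1] e0.
have : (fun n => c / (1 - q) * q ^+ n) @ \oo --> c / (1 - q) * 0.
  by apply: cvgMr; apply: cvg_expr; rewrite ger0_norm.
rewrite mulr0 => /cvgr0Pnorm_lt /(_ _ e0)[N _ /(_ N (leqnn N))] /= h.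
exists N; apply: le_lt_trans h.
by apply: le_trans (ler_norm _); rewrite mulrAC.
Qed.

(** Telescoping bounds each finite distance by a geometric sum. The explicit tail estimate is what
    the contraction principle and the gliding hump use. *)
Lemma geometric_limit (u : nat -> V) (c q : R) : 0 <= q < 1 ->
  (forall n, rnorm (u n.+1 - u n) <= c * q ^+ n) ->
  exists l, forall n, rnorm (l - u n) <= c * q ^+ n / (1 - q).
Proof.
move=> q01 step; have /andP[q0 q1] := q01.
have q1' : 0 < 1 - q by rewrite subr_gt0.
have c0 : 0 <= c.
  by have := le_trans (rnorm_ge0 _) (step 0%N); rewrite expr0 mulr1.
have dist n k : rnorm (u (n + k)%N - u n) <= c * q ^+ n / (1 - q).
  (* The sharper bound is the exact partial geometric sum, so that the induction on [k] closes with
     equality. *)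
  suff : rnorm (u (n + k)%N - u n) <= c * q ^+ n * (1 - q ^+ k) / (1 - q).
    move/le_trans; apply; rewrite ler_pM2r ?invr_gt0 //.
    rewrite ler_piMr ?mulr_ge0 ?exprn_ge0 //.
    by rewrite gerBl exprn_ge0.
  elim: k => [|k IH]; first by rewrite addn0 subrr rnorm0 expr0 subrr !mulr0 mul0r.
  apply: le_trans (rnorm_dist _ (u (n + k)%N) _) _.
  rewrite addnS; apply: le_trans (lerD (step _) IH) _.
  rewrite le_eqVlt; apply/orP; left; apply/eqP.
  rewrite exprD exprS; field.
  by rewrite gt_eqF.
have : cauchy (u @ \oo).
  apply/cauchy_ballP => e e0.
  (* The radius [e] lies in [R[i]]; positivity there forces it to be real. *)
  have e0' : 0 < complex.Re e.
    by move: e0; rewrite ltcE => /andP[_].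
  have eE : e = (complex.Re e)%:C%C by rewrite RRe_real // gtr0_real.
  have [N hN] := @geometric_small c _ (complex.Re e / 2) q01 ltac:(lra).
  pose tail := u @` [set n | (N <= n)%N].
  have utail : (u @ \oo) tail by exists N => // n Nn; exists n.
  exists (tail, tail) => // -[_ _] [/= [m Nm <-] [n Nn <-]].
  rewrite -ball_normE /ball_ /= eE rnormE ltcR.
  apply: le_lt_trans (rnorm_dist _ (u N) _) _; rewrite (rnormB (u N)).
  have := dist N (m - N)%N; have := dist N (n - N)%N; rewrite !subnKC //; lra.
move/cauchy_cvg => /cvg_ex[l ul]; exists l => n.
apply/ler_addgt0Pl => e e0.
have := (@cvgr_dist_lt _ _ _ _ _ _ _ ul) (e%:C%C).
rewrite ltcR => /(_ _ e0) [N _ hN].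
have := hN (maxn N n) (leq_maxl _ _).
rewrite /= rnormE ltcR => h.
apply: le_trans (rnorm_dist _ (u (maxn N n)) _) _.
have := dist n (maxn N n - n)%N; rewrite subnKC ?leq_maxr //; lra.
Qed.

Definition norm_closed (S : set V) :=
  forall l, (forall e : R, 0 < e -> exists2 x, S x & rnorm (l - x) < e) -> S l.

(** Banach's fixed point theorem. The closed invariant set [S] carries norm bounds, selfadjointness
    and commutation relations over to the fixed point. *)
Lemma contraction_fixpoint (S : set V) (F : V -> V) (q : R) :
  0 <= q < 1 -> norm_closed S -> S !=set0 -> (forall x, S x -> S (F x)) ->
  (forall x y, S x -> S y -> rnorm (F x - F y) <= q * rnorm (x - y)) ->
  exists2 x, S x & F x = x.
Proof.
move=> q01 Scl [x0 Sx0] FS Fq.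
pose u n := iter n F x0.
have Su n : S (u n) by elim: n => [//|n IH]; apply: FS.
have step n : rnorm (u n.+1 - u n) <= rnorm (u 1%N - u 0%N) * q ^+ n.
  elim: n => [|n IH]; first by rewrite expr0 mulr1.
  apply: (le_trans (Fq (u n.+1) (u n) (Su _) (Su _))).
  by rewrite exprS mulrCA ler_wpM2l //; case/andP: q01.
have [l hl] := geometric_limit q01 step.
have /andP[q0 q1] := q01.
have Sl : S l.
  apply: Scl => e e0.
  have [n hn] := geometric_small (rnorm (u 1%N - u 0%N)) q01 e0.
  by exists (u n) => //; apply: le_lt_trans hn.
exists l => //; apply/eqP; rewrite -subr_eq0; apply/eqP; apply: rnorm_eq0.
apply/eqP; rewrite eq_le rnorm_ge0 andbT; apply/ler_addgt0Pl => e e0.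
rewrite addr0.
(* Both [F l] and [l] lie within the tail estimate at [n] of [u n.+1], and [n] makes this estimate
   less than [e / 2]. *)
have [n hn] := geometric_small (rnorm (u 1%N - u 0%N)) q01 (divr_gt0 e0 (ltr0Sn _ 1)).
have hl1 := hl n; have hl2 := hl n.+1.
have hF : rnorm (F l - u n.+1) <= q * rnorm (l - u n) by apply: Fq.
have qn : q * rnorm (l - u n) <= rnorm (l - u n).
  by rewrite ler_piMl ?rnorm_ge0 ?(ltW q1).
apply: le_trans (rnorm_dist _ (u n.+1) _) _; rewrite (rnormB (u n.+1)).
move: hl2; rewrite exprS mulrCA -mulrA => hl2.
have : q * (rnorm (u 1%N - u 0%N) * q ^+ n / (1 - q)) <=
    rnorm (u 1%N - u 0%N) * q ^+ n / (1 - q).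
  by rewrite ler_piMl ?(ltW q1) // (le_trans (rnorm_ge0 _) hl1).
lra.
Qed.

End Limits.

(** * The unitization of a C*-algebra *)

Section Unitization.
Context (R : realType) (A : cstarAlgType R).

Lemma cmul0r (a : A) : cmul 0 a = 0.
Proof. by rewrite -(scale0r (0 : A)) cmulZl !scale0r. Qed.

Lemma cmulr0 (a : A) : cmul a 0 = 0.
Proof. by rewrite -(scale0r (0 : A)) cmulZr !scale0r. Qed.

Lemma cmulNr (a b : A) : cmul a (- b) = - cmul a b.
Proof. by rewrite -scaleN1r cmulZr scaleN1r. Qed.

Lemma cmulNl (a b : A) : cmul (- a) b = - cmul a b.
Proof. by rewrite -scaleN1r cmulZl scaleN1r. Qed.

Lemma cstarN (a : A) : cstar (- a) = - cstar a.
Proof. by rewrite -scaleN1r cstarZ rmorphN rmorph1 scaleN1r. Qed.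

Lemma cstar0 : cstar (0 : A) = 0.
Proof. by rewrite -(scale0r (0 : A)) cstarZ rmorph0 !scale0r. Qed.

Lemma rnormM (a b : A) : rnorm (cmul a b) <= rnorm a * rnorm b.
Proof. rewrite -lecR rmorphM /= -!rnormE. exact: cmul_norm. Qed.

Lemma rnorm_starM (a : A) : rnorm (cmul (cstar a) a) = rnorm a ^+ 2.
Proof. by apply: complexI; rewrite rmorphXn /= -!rnormE cstar_norm. Qed.

(** The C*-identity gives [|b|^2 = |b* b| <= |b*| |b|]; divide by [|b|], and apply the result to
    [b*] as well. *)
Lemma rnorm_star (a : A) : rnorm (cstar a) = rnorm a.
Proof.
suff le (b : A) : rnorm b <= rnorm (cstar b).
  by apply/eqP; rewrite eq_le le andbT -{2}(cstarK a) le.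
have [b0|b0] := eqVneq (rnorm b) 0; first by rewrite b0 rnorm_ge0.
have b_gt0 : 0 < rnorm b by rewrite lt_def b0 rnorm_ge0.
by rewrite -(ler_pM2r b_gt0) -expr2 -rnorm_starM rnormM.
Qed.

(** A name of its own for the pairs, so that they carry [unitization_mul] as ring product and not a
    componentwise one. *)
Definition unitization := (R[i] * A)%type.

HB.instance Definition _ := GRing.Zmodule.copy unitization (R[i] * A)%type.

Fact unitization_mulA : associative (@unitization_mul R A).
Proof.
move=> [x a] [y b] [z c]; rewrite /unitization_mul /= mulrA; congr pair.
rewrite !scalerDr !cmulDl !cmulDr !cmulZl !cmulZr !scalerA cmulA -!addrA.
rewrite [z * y]mulrC [z * x]mulrC; congr (_ + _).
congr (_ + _); rewrite [LHS]addrCA; congr (_ + _).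
by rewrite (addrCA (y *: _)) [LHS]addrCA.
Qed.

Fact unitization_mul1l : left_id ((1, 0) : unitization) (@unitization_mul R A).
Proof.
by move=> [x a]; rewrite /unitization_mul /= mul1r scale1r scaler0 cmul0r !addr0.
Qed.

Fact unitization_mul1r : right_id ((1, 0) : unitization) (@unitization_mul R A).
Proof.
by move=> [x a]; rewrite /unitization_mul /= mulr1 scale1r scaler0 cmulr0 add0r addr0.
Qed.

Fact unitization_mulDl :
  left_distributive (@unitization_mul R A : unitization -> _ -> _) +%R.
Proof.
move=> [x a] [y b] [z c]; rewrite /unitization_mul /= mulrDl; congr pair.
by rewrite scalerDl scalerDr cmulDl /= [RHS]addrACA; congr (_ + _); rewrite addrACA.
Qed.

Fact unitization_mulDr :
  right_distributive (@unitization_mul R A : unitization -> _ -> _) +%R.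
Proof.
move=> [x a] [y b] [z c]; rewrite /unitization_mul /= mulrDr; congr pair.
by rewrite scalerDl scalerDr cmulDr /= [RHS]addrACA; congr (_ + _); rewrite addrACA.
Qed.

Fact unitization_oner_neq0 : ((1, 0) : unitization) != 0.
Proof. by apply/eqP => -[/eqP]; rewrite oner_eq0. Qed.

HB.instance Definition _ := GRing.Zmodule_isNzRing.Build unitization
  unitization_mulA unitization_mul1l unitization_mul1r unitization_mulDl
  unitization_mulDr unitization_oner_neq0.

Implicit Types u v w : unitization.

Lemma umulE u v :
  u * v = (u.1 * v.1, u.1 *: v.2 + v.1 *: u.2 + cmul u.2 v.2) :> unitization.
Proof. by []. Qed.

Definition ustar u : unitization := (u.1^*, cstar u.2).

Lemma ustarD u v : ustar (u + v) = ustar u + ustar v.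
Proof. by congr pair; rewrite /= ?rmorphD ?cstarD. Qed.

Lemma ustarN u : ustar (- u) = - ustar u.
Proof. by congr pair; rewrite /= ?rmorphN ?cstarN. Qed.

Lemma ustarM u v : ustar (u * v) = ustar v * ustar u.
Proof.
rewrite !umulE; congr pair => /=; first by rewrite rmorphM mulrC.
by rewrite !cstarD !cstarZ cstarM; congr (_ + _); rewrite addrC.
Qed.

Definition uideal (a : A) : unitization := (0, a).

Definition uscal (z : R[i]) : unitization := (z, 0).

Lemma uscal_is_zmod_morphism : zmod_morphism uscal.
Proof. by move=> x y; congr pair; rewrite subr0. Qed.

Lemma uscal_is_monoid_morphism : monoid_morphism uscal.
Proof.
by split => // x y; rewrite umulE /= !scaler0 cmul0r !addr0.
Qed.

HB.instance Definition _ :=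
  GRing.isZmodMorphism.Build R[i] unitization uscal uscal_is_zmod_morphism.
HB.instance Definition _ :=
  GRing.isMonoidMorphism.Build R[i] unitization uscal uscal_is_monoid_morphism.

Lemma ustar_scal z : ustar (uscal z) = uscal z^*.
Proof. by rewrite /ustar /= cstar0. Qed.

Lemma ustar1 : ustar 1 = 1.
Proof. by rewrite -(rmorph1 uscal) ustar_scal !rmorph1. Qed.

Lemma uscalC z u : uscal z * u = u * uscal z.
Proof.
by rewrite !umulE /= !scaler0 cmul0r cmulr0 mulrC !addr0 !add0r.
Qed.

Lemma uscalM z u : uscal z * u = (z * u.1, z *: u.2) :> unitization.
Proof. by rewrite umulE /= scaler0 cmul0r !addr0. Qed.

Lemma unitizationP u v : GRing.comm u v <-> cmul u.2 v.2 = cmul v.2 u.2.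
Proof.
rewrite /GRing.comm !umulE mulrC; split=> [[]|->].
  by rewrite (addrC (u.1 *: _)) => /addrI.
by rewrite (addrC (u.1 *: _)).
Qed.

Definition uinvertible u := exists2 v, u * v = 1 & v * u = 1.

Lemma uinvertible_scal z : z != 0 -> uinvertible (uscal z).
Proof. by move=> z0; exists (uscal z^-1); rewrite -rmorphM ?mulfV ?mulVf ?rmorph1. Qed.

Lemma uinvertibleM u v : uinvertible u -> uinvertible v -> uinvertible (u * v).
Proof.
move=> [u' uu' u'u] [v' vv' v'v]; exists (v' * u').
  by rewrite mulrA -(mulrA u) vv' mulr1.
by rewrite mulrA -(mulrA v') u'u mulr1.
Qed.

(** With [w] inverse to [u * v], the element [v * w] is a right inverse of [u] and, by commutation,
    [w * v] a left inverse; the two agree. *)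
Lemma uinvertible_factor u v :
  GRing.comm u v -> uinvertible (u * v) -> uinvertible u.
Proof.
move=> uv [w uvw wuv].
have wvu : w * v * u = 1 by rewrite -mulrA -uv.
have e : v * w = w * v.
  by rewrite -[LHS]mul1r -wvu -[LHS]mulrA (mulrA u) uvw mulr1.
by exists (v * w); [rewrite mulrA | rewrite e].
Qed.

(** This sum norm is not the C*-norm of the unitization, but it is enough for Neumann series and for
    square roots near [1]. *)
Definition unorm u : R := Normc.normc u.1 + rnorm u.2.

Lemma normcr (r : R) : Normc.normc r%:C%C = `|r|.
Proof. by rewrite /= expr0n addr0 sqrtr_sqr. Qed.

Lemma normc_ge0 (z : R[i]) : 0 <= Normc.normc z.
Proof. by case: z => x y; apply: sqrtr_ge0. Qed.

Lemma unorm_ge0 u : 0 <= unorm u.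
Proof. by rewrite addr_ge0 ?normc_ge0 ?rnorm_ge0. Qed.

Lemma unorm_scalM z u : unorm (uscal z * u) = Normc.normc z * unorm u.
Proof. by rewrite uscalM /unorm /= Normc.normcM rnormZ mulrDr. Qed.

(* Fixed point of [y |-> a + a y]. *)
Lemma neumann_ideal (a : A) : rnorm a < 1 -> uinvertible (1 - uideal a).
Proof.
move=> a1; have q01 : 0 <= rnorm a < 1 by rewrite rnorm_ge0.
have [||||y _ yE] := @contraction_fixpoint R A setT (fun y => a + cmul a y) _ q01.
- by [].
- by exists 0.
- by [].
- move=> x y _ _; rewrite opprD addrACA subrr add0r -cmulNr -cmulDr.
  exact: rnormM.
have [||||y' _ yE'] := @contraction_fixpoint R A setT (fun y => a + cmul y a) _ q01.
- by [].
- by exists 0.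
- by [].
- move=> x x' _ _; rewrite opprD addrACA subrr add0r -cmulNl -cmulDl mulrC.
  exact: rnormM.
pose Y : unitization := (1, y); pose Y' : unitization := (1, y').
have YE : (1 - uideal a) * Y = 1.
  rewrite umulE /= subr0 mulr1; congr pair.
  by rewrite !scale1r sub0r cmulNl -{1}yE addrAC addrK subrr.
have YE' : Y' * (1 - uideal a) = 1.
  rewrite umulE /= subr0 mulr1; congr pair.
  by rewrite !scale1r sub0r cmulNr -{1}yE' addKr subrr.
exists Y => //.
by rewrite -[Y]mul1r -{1}YE' -[Y' * _ * Y]mulrA YE mulr1.
Qed.

(** Factoring out the scalar [1 - z] reduces to [neumann_ideal], since
    [|a| < 1 - |z| <= |1 - z|]. *)
Lemma neumann u : unorm u < 1 -> uinvertible (1 - u).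
Proof.
rewrite /unorm; set z := u.1; set a := u.2 => za.
have z1 : Normc.normc z < 1 by have := rnorm_ge0 a; lra.
have zlt : 1 - Normc.normc z <= Normc.normc (1 - z).
  have := le_normcD (1 - z) z; rewrite subrK Normc.normc1; lra.
have z0 : 1 - z != 0.
  by apply: contraTneq zlt => ->; rewrite Normc.normc0; apply/negP; lra.
have -> : 1 - u = uscal (1 - z) * (1 - uideal ((1 - z)^-1 *: a)).
  rewrite uscalM [u]surjective_pairing /= subr0 mulr1; congr pair.
  by rewrite !sub0r scalerN scalerA mulfV // scale1r.
apply: uinvertibleM (uinvertible_scal z0) _.
apply: neumann_ideal; rewrite rnormZ Normc.normcV.
have p0 : 0 < Normc.normc (1 - z) by lra.
rewrite mulrC ltr_pdivrMr // mul1r; lra.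
Qed.

End Unitization.

(** * Square roots in the unitization *)

Section SquareRoots.
Context (R : realType) (A : cstarAlgType R).
Implicit Types u v w h b c : unitization A.

Lemma rnorm_small (v : A) (C : R) :
  0 <= C -> (forall e : R, 0 < e -> rnorm v <= C * e) -> v = 0.
Proof.
move=> C0 vC; apply: rnorm_eq0; apply/eqP; rewrite eq_le rnorm_ge0 andbT.
apply/ler_addgt0Pl => e e0; rewrite addr0.
have C1 : 0 < C + 1 by lra.
apply: le_trans (vC (e / (C + 1)) (divr_gt0 e0 C1)) _.
rewrite mulrCA ger_pMr // ler_pdivrMr //; lra.
Qed.

(* Fixed point of [y |-> (a + y^2) / 2]; then [(1 - y)^2 = 1 - a]. *)
Lemma half_quadratic_fixpoint (a : A) : cstar a = a -> rnorm a < 1 ->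
  exists y : A, [/\ cstar y = y,
    forall d : A, cmul d a = cmul a d -> cmul d y = cmul y d
    & y + y = a + cmul y y].
Proof.
move=> aa a1; set q := rnorm a in a1.
have q0 : 0 <= q by apply: rnorm_ge0.
(* On the ball of radius [q] the map is [q]-Lipschitz because [x^2 - y^2 = x (x - y) + (x - y) y];
   selfadjointness and commutation with the commutant of [a] are closed conditions that the map
   preserves. *)
pose S := [set y : A | [/\ rnorm y <= q, cstar y = y
  & forall d : A, cmul d a = cmul a d -> cmul d y = cmul y d]].
have n2 : Normc.normc (2^-1 : R[i]) = 2^-1.
  have -> : (2^-1 : R[i]) = (2^-1 : R)%:C%C by rewrite fmorphV rmorph_nat.
  by rewrite normcr ger0_norm // invr_ge0.
have [|||||y [_ ys yc] yE] :=
  @contraction_fixpoint R A S (fun y => 2^-1 *: (a + cmul y y)) q _ _ _ _.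
- by rewrite q0.
- move=> l hl; split.
  + apply/ler_addgt0Pl => e e0; have [x [xq _ _] xl] := hl e e0.
    have := rnormD (l - x) x; rewrite subrK; lra.
  + apply/eqP; rewrite -subr_eq0; apply/eqP; apply: (@rnorm_small _ 2) => // e e0.
    have [x [_ xs _] xl] := hl e e0.
    apply: le_trans (rnorm_dist _ x _) _.
    rewrite -{1}xs -cstarN -cstarD rnorm_star (rnormB x); lra.
  + move=> d da; apply/eqP; rewrite -subr_eq0; apply/eqP.
    apply: (@rnorm_small _ (2 * rnorm d)); first by rewrite mulr_ge0 ?rnorm_ge0.
    move=> e e0; have [x [_ _ xd] xl] := hl e e0.
    apply: le_trans (rnorm_dist _ (cmul d x) _) _.
    rewrite {2}xd // -(cmulNr d) -(cmulNl l) -cmulDr -cmulDl.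
    have := rnormM d (l - x); have := rnormM (x - l) d; rewrite (rnormB x).
    have : rnorm d * rnorm (l - x) <= rnorm d * e.
      by rewrite ler_wpM2l ?rnorm_ge0 // ltW.
    rewrite (mulrC _ (rnorm d)); lra.
- exists 0; split; first by rewrite rnorm0.
    by rewrite cstar0.
  by move=> d _; rewrite cmul0r cmulr0.
- move=> y [yq ys yc]; split.
  + rewrite rnormZ n2; have := rnormD a (cmul y y); have := rnormM y y.
    have : rnorm y * rnorm y <= 1 * q by rewrite ler_pM ?rnorm_ge0 //; lra.
    rewrite -/q; lra.
  + rewrite cstarZ cstarD cstarM ys aa; congr (_ *: _).
    by rewrite fmorphV rmorph_nat.
  + move=> d da; rewrite cmulZr cmulZl cmulDr cmulDl da.
    by rewrite cmulA (yc d) // -cmulA (yc d) // cmulA.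
- move=> x y [xq _ _] [yq _ _].
  have -> : 2^-1 *: (a + cmul x x) - 2^-1 *: (a + cmul y y) =
      2^-1 *: (cmul x (x - y) + cmul (x - y) y).
    rewrite -scalerBr opprD addrACA subrr add0r; congr (_ *: _).
    by rewrite cmulDr cmulDl cmulNr cmulNl addrA subrK.
  rewrite rnormZ n2; have := rnormD (cmul x (x - y)) (cmul (x - y) y).
  have := rnormM x (x - y); have := rnormM (x - y) y.
  have : rnorm x * rnorm (x - y) <= q * rnorm (x - y).
    by rewrite ler_wpM2r ?rnorm_ge0.
  have : rnorm (x - y) * rnorm y <= q * rnorm (x - y).
    by rewrite mulrC ler_wpM2r ?rnorm_ge0.
  lra.
exists y; split => //; rewrite -[in LHS]yE -scalerDl.
by rewrite -[X in X + X]mul1r -mulrDl divff ?scale1r // pnatr_eq0.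
Qed.

(** Elements of this kind commute with each other, which makes square roots multiplicative. *)
Definition bicommutant h b :=
  ustar b = b /\ forall c, GRing.comm c h -> GRing.comm c b.

Lemma bicommutant_comm h b c :
  bicommutant h b -> bicommutant h c -> GRing.comm b c.
Proof.
move=> [_ hb] [_ hc]; apply: hc; apply: commr_sym; apply: hb; exact: commr_refl.
Qed.

Lemma bicommutantM h b c :
  bicommutant h b -> bicommutant h c -> bicommutant h (b * c).
Proof.
move=> hb hc; split.
  by rewrite ustarM hb.1 hc.1 (bicommutant_comm hb hc).
by move=> d dh; apply: commrM; [apply: hb.2 | apply: hc.2].
Qed.

Lemma bicommutantD h b c :
  bicommutant h b -> bicommutant h c -> bicommutant h (b + c).
Proof.
move=> hb hc; split; first by rewrite ustarD hb.1 hc.1.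
by move=> d dh; apply: commrD; [apply: hb.2 | apply: hc.2].
Qed.

Lemma bicommutant_scal h (r : R) : bicommutant h (uscal A r%:C%C).
Proof.
split; first by rewrite ustar_scal; congr uscal; apply: conjc_real.
by move=> d _; rewrite /GRing.comm uscalC.
Qed.

Lemma bicommutant_id h : ustar h = h -> bicommutant h h.
Proof. by []. Qed.

Lemma bicommutantV h b c : bicommutant h b -> b * c = 1 -> c * b = 1 ->
  bicommutant h c.
Proof.
move=> [bs hb] bc cb; split.
  rewrite -[LHS]mul1r -cb -mulrA -{1}bs -ustarM.
  by rewrite -[c * ustar _]/(c * _) cb ustar1 mulr1.
move=> d /hb db; rewrite /GRing.comm.
by rewrite -[d * c]mul1r -cb -!mulrA (mulrA b) -db -mulrA bc mulr1.
Qed.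

Definition has_sqrt h u := exists2 b, bicommutant h b & b * b = u.

Lemma has_sqrtM h u v : has_sqrt h u -> has_sqrt h v -> has_sqrt h (u * v).
Proof.
move=> [b hb <-] [c hc <-]; exists (b * c); first exact: bicommutantM.
by rewrite mulrA -(mulrA b c) -(bicommutant_comm hb hc) !mulrA.
Qed.

Lemma has_sqrt_scal h (r : R) : 0 <= r -> has_sqrt h (uscal A r%:C%C).
Proof.
move=> r0; exists (uscal A (Num.sqrt r)%:C%C); first exact: bicommutant_scal.
by rewrite -!rmorphM /= -expr2 sqr_sqrtr.
Qed.

(** Selfadjointness makes the scalar part a real [r < 1]. Then [1 - u = (1 - r)(1 - a)] with
    [|a| < 1], and [y] with [2 y = a + y^2] gives the root [1 - y] of the second factor. *)
Lemma has_sqrt_sub1 h u : bicommutant h u -> unorm u < 1 -> has_sqrt h (1 - u).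
Proof.
move=> hu; rewrite /unorm => u1.
have [us _] := hu.
have zr : u.1 = (complex.Re u.1)%:C%C.
  have : u.1^* = u.1 by rewrite -[in RHS]us.
  by move/CrealP/RRe_real.
set r := complex.Re u.1 in zr; move: u1; rewrite zr normcr => u1.
have r1 : 0 < 1 - r by have := rnorm_ge0 u.2; have := ler_norm r; lra.
have aE : cstar u.2 = u.2 by rewrite -[in RHS]us.
pose a := ((1 - r)^-1)%:C%C *: u.2.
have as_ : cstar a = a by rewrite cstarZ aE; congr (_ *: _); apply: conjc_real.
have a1 : rnorm a < 1.
  rewrite rnormZr ger0_norm ?invr_ge0 ?ltW // mulrC ltr_pdivrMr // mul1r.
  have := ler_norm r; lra.
have [y [ys yc yE]] := half_quadratic_fixpoint as_ a1.
have -> : 1 - u = uscal A (1 - r)%:C%C * (1 - uideal a).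
  rewrite uscalM [u]surjective_pairing zr /= subr0 mulr1; congr pair.
    by rewrite rmorphB.
  by rewrite !sub0r scalerN scalerA -rmorphM mulfV ?gt_eqF // rmorph1 scale1r.
apply: has_sqrtM; first exact/has_sqrt_scal/ltW.
exists (1 - uideal y).
  split.
    by rewrite ustarD ustarN ustar1; congr (_ - _); rewrite /ustar /= ys rmorph0.
  move=> c /(hu.2) /unitizationP cu.
  apply: commrB; first exact: commr1.
  by apply/unitizationP/yc; rewrite cmulZl cmulZr cu.
have -> : uideal a = uideal y + uideal y - uideal y * uideal y.
  by congr pair; rewrite /= ?mulr0 ?addr0 ?subr0 // !scale0r !add0r yE addrK.
rewrite mulrBl mul1r mulrBr mulr1 !opprB opprD -addrA.
by rewrite (addrCA (- uideal y)).
Qed.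

(* Hence having a square root propagates down from large [s]. *)
Lemma has_sqrt_shift_local h (s0 : R) : ustar h = h ->
  uinvertible (h + uscal A s0%:C%C) ->
  exists2 d : R, 0 < d & forall s, `|s - s0| < d ->
    has_sqrt h (h + uscal A s%:C%C) <-> has_sqrt h (h + uscal A s0%:C%C).
Proof.
move=> hs [v hv vh].
have bh : bicommutant h (h + uscal A s0%:C%C).
  by apply: bicommutantD; [apply: bicommutant_id | apply: bicommutant_scal].
have bv : bicommutant h v := bicommutantV bh hv vh.
have n0 := unorm_ge0 v.
(* Within this radius [x] has norm below [1] and [h + s = (h + s0)(1 - x)]. The root [y] of [1 - x]
   is invertible since its square is, so the inverse of [1 - x] has a root too and both implications
   follow. *)
exists (unorm v + 1)^-1; first by rewrite invr_gt0; lra.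
move=> s sd; pose x := uscal A (s0 - s)%:C%C * v.
have hx : bicommutant h x by apply: bicommutantM bv; apply: bicommutant_scal.
have x1 : unorm x < 1.
  rewrite unorm_scalM normcr distrC.
  have : `|s - s0| * (unorm v + 1) < 1 by rewrite -ltr_pdivlMr ?mul1r //; lra.
  have := normr_ge0 (s - s0); lra.
have sE : h + uscal A s%:C%C = (h + uscal A s0%:C%C) * (1 - x).
  rewrite mulrBr mulr1 /x mulrA -uscalC -mulrA hv mulr1 -addrA -rmorphB -rmorphB /=.
  by congr (h + uscal A _%:C%C); rewrite opprB addrC subrK.
have [y hy yx] := has_sqrt_sub1 hx x1.
have [w yw wy] : uinvertible y.
  apply: (@uinvertible_factor _ _ y y); first exact: commr_refl.
  by rewrite yx; apply: neumann.
have hw := bicommutantV hy yw wy.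
have ww : (1 - x) * (w * w) = 1 by rewrite -yx -mulrA (mulrA y w) yw mul1r yw.
rewrite sE; split=> [r|r].
  rewrite -[h + _]mulr1 -ww mulrA; apply: has_sqrtM r _.
  by exists w.
by apply: has_sqrtM r _; exists y.
Qed.

(** Large [s] give a root because [h + s = s (1 - (- h / s))] with [|h / s| < 1]. By local constancy
    the set of [s >= s1] without a root cannot have a supremum, hence is empty. *)
Lemma has_sqrt_shift h : ustar h = h ->
  (forall s : R, 0 < s -> uinvertible (h + uscal A s%:C%C)) ->
  forall s : R, 0 < s -> has_sqrt h (h + uscal A s%:C%C).
Proof.
move=> hs hinv.
have large (s : R) : unorm h < s -> has_sqrt h (h + uscal A s%:C%C).
  move=> sh; have s0 : 0 < s by have := unorm_ge0 h; lra.
  have -> : h + uscal A s%:C%C = uscal A s%:C%C * (1 - uscal A (- s^-1)%:C%C * h).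
    rewrite mulrBr mulr1 mulrA -rmorphM /= -rmorphM /= mulrN mulfV ?gt_eqF //.
    by rewrite !rmorphN1 mulN1r opprK addrC.
  apply: has_sqrtM; first exact/has_sqrt_scal/ltW.
  apply: has_sqrt_sub1.
    apply: bicommutantM; first exact: bicommutant_scal.
    exact: bicommutant_id.
  by rewrite unorm_scalM normcr normrN gtr0_norm ?invr_gt0 // mulrC ltr_pdivrMr ?mul1r.
move=> s1 s10; apply: contrapT => ns1.
pose E := [set s | s1 <= s /\ ~ has_sqrt h (h + uscal A s%:C%C)].
have supE : has_sup E.
  split; first by exists s1; split.
  exists (unorm h) => s [_ ns]; rewrite leNgt; apply/negP => /large; exact: ns.
have s1sup : s1 <= sup E by apply: sup_upper_bound => //; split.
have [d d0 hd] := has_sqrt_shift_local hs (hinv _ (lt_le_trans s10 s1sup)).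
(* There is no root at [s], within [d] of the supremum, but there is one at [sup E + d / 2], which
   lies outside [E]; this contradicts local constancy at [sup E]. *)
have [s [s1s ns] ds] := sup_adherent d0 supE.
have sle : s <= sup E by apply: sup_upper_bound => //; split.
apply: ns; apply/hd; first by rewrite ltr_norml; lra.
apply/(hd (sup E + d / 2)); first by rewrite ltr_norml; lra.
apply: contrapT => n2.
have : sup E + d / 2 <= sup E by apply: sup_upper_bound => //; split=> //; lra.
lra.
Qed.

End SquareRoots.

(** * Monotonicity of the norm on positive elements *)

Section PositiveElements.
Context (R : realType) (A : cstarAlgType R).
Implicit Types u v w h b c : unitization A.

Definition uact u (x : A) : A := u.1 *: x + cmul u.2 x.

Lemma uideal_uact u x : uideal (uact u x) = u * uideal x.
Proof. by congr pair; rewrite /= ?mulr0 // scale0r addr0. Qed.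

Lemma uactM u v x : uact (u * v) x = uact u (uact v x).
Proof.
suff [] : uideal (uact (u * v) x) = uideal (uact u (uact v x)) by [].
by rewrite !uideal_uact mulrA.
Qed.

Lemma uactD u v x : uact (u + v) x = uact u x + uact v x.
Proof. by rewrite /uact /= scalerDl cmulDl addrACA. Qed.

Lemma uscalrN (r : R) : - uscal A r%:C%C = uscal A (- r)%:C%C.
Proof. by rewrite !rmorphN. Qed.

Lemma unorm_ideal (a : A) : unorm (uideal a) = rnorm a.
Proof. by rewrite /unorm Normc.normc0 add0r. Qed.

Lemma uact_scal z x : uact (uscal A z) x = z *: x.
Proof. by rewrite /uact /= cmul0r addr0. Qed.

Lemma uact_ideal a x : uact (uideal a) x = cmul a x.
Proof. by rewrite /uact /= scale0r add0r. Qed.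

Lemma cmul_star_uact u x y :
  cmul (cstar (uact u x)) y = cmul (cstar x) (uact (ustar u) y).
Proof.
by rewrite /uact cstarD cstarZ cstarM cmulDl cmulDr cmulZl cmulZr cmulA.
Qed.

(** [C] bounds the operator norm of left multiplication by [u] on [A]. Unlike [unorm], this operator
    norm satisfies the C*-identity, and on [A] itself it gives back the norm. *)
Definition ubound u (C : R) := forall x : A, rnorm (uact u x) <= C * rnorm x.

Lemma uboundD u v C D : ubound u C -> ubound v D -> ubound (u + v) (C + D).
Proof.
move=> uC vD x; rewrite uactD mulrDl; apply: le_trans (rnormD _ _) _.
exact: lerD.
Qed.

Lemma uboundX u C n : 0 <= C -> ubound u C -> ubound (u ^+ n) (C ^+ n).
Proof.
move=> C0 uC; elim: n => [|n IH] x.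
  by rewrite !expr0 -(rmorph1 (uscal A)) uact_scal scale1r mul1r.
rewrite !exprS uactM; apply: le_trans (uC _) _.
by rewrite -mulrA ler_wpM2l.
Qed.

(** [|u x|^2 = |x* u* u x| = r^2 |x|^2]. *)
Lemma ubound_isometry u (r : R) : 0 <= r -> ustar u * u = uscal A (r ^+ 2)%:C%C ->
  ubound u r.
Proof.
move=> r0 uu x; rewrite -ler_sqr ?nnegrE ?mulr_ge0 ?rnorm_ge0 //.
rewrite -rnorm_starM cmul_star_uact -uactM uu uact_scal cmulZr rnormZr.
by rewrite rnorm_starM ger0_norm ?sqr_ge0 // exprMn.
Qed.

(** Test on [cstar a], where [|a a*| = |a|^2]. *)
Lemma ubound_ideal (a : A) C : 0 <= C -> ubound (uideal a) C -> rnorm a <= C.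
Proof.
move=> C0 aC; have := aC (cstar a); rewrite uact_ideal.
have := rnorm_starM (cstar a); rewrite cstarK rnorm_star => ->.
have [->//|a0] := eqVneq (rnorm a) 0.
by rewrite expr2 ler_pM2r // lt_def a0 rnorm_ge0.
Qed.

Lemma ubound_ge u C z : u.1 = z -> ubound u C -> 0 <= C ->
  rnorm u.2 <= C + Normc.normc z.
Proof.
move=> uz uC C0; apply: ubound_ideal; first by rewrite addr_ge0 ?normc_ge0.
have -> : uideal u.2 = u + uscal A (- z).
  by rewrite [u in RHS]surjective_pairing uz; congr pair; rewrite /= ?subrr ?addr0.
apply: uboundD => // x.
by rewrite uact_scal rnormZ normcN.
Qed.

Lemma mulr_subl_addl c b : GRing.comm c b -> (c - b) * (c + b) = c * c - b * b.
Proof. by move=> cb; rewrite mulrBl !mulrDr -cb opprD addrA addrK. Qed.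

Lemma uinvertibleN u : uinvertible u -> uinvertible (- u).
Proof. by move=> [v uv vu]; exists (- v); rewrite mulrNN. Qed.

(* If [r^2 - c^2 = b^2], then [c + ib] is [r] times a unitary, with real part [c]. *)
Lemma ubound_real_spectrum c (t : R) : ustar c = c -> 0 <= t ->
  (forall x : R, t < `|x| -> uinvertible (c - uscal A x%:C%C)) -> ubound c t.
Proof.
move=> cs t0 cinv x.
suff bound (r : R) : t < r -> ubound c r.
  apply/ler_addgt0Pl => e e0; have n0 := rnorm_ge0 x.
  have n1 : 0 < rnorm x + 1 by lra.
  have d0 : 0 < e / (rnorm x + 1) by rewrite divr_gt0.
  have := bound (t + e / (rnorm x + 1)) ltac:(lra) x.
  rewrite mulrDl => /le_trans; apply.
  rewrite addrC lerD2r -mulrA ger_pMr // mulrC ler_pdivrMr //; lra.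
move=> tr; have r0 : 0 < r by lra.
(* [h + (q^2 - t^2) = q^2 - c^2 = (q - c)(q + c)] is invertible for [q > t] by hypothesis, so every
   positive shift of [h] has a square root, in particular [r^2 - c^2]. *)
pose h := uscal A (t ^+ 2)%:C%C - c * c.
have hc : GRing.comm c h.
  apply: commrB; first by rewrite /GRing.comm uscalC.
  by apply: commrM; apply: commr_refl.
have hs : ustar h = h.
  rewrite ustarD ustarN ustarM ustar_scal cs; congr (uscal A _ - _).
  exact: conjc_real.
have hE (q : R) : h + uscal A (q ^+ 2 - t ^+ 2)%:C%C = uscal A (q ^+ 2)%:C%C - c * c.
  by rewrite rmorphB rmorphB /= addrC addrA subrK.
have hinv (s : R) : 0 < s -> uinvertible (h + uscal A s%:C%C).
  move=> s0; pose q : R := Num.sqrt (t ^+ 2 + s).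
  have t20 := sqr_ge0 t.
  have q2 : q ^+ 2 = t ^+ 2 + s by rewrite sqr_sqrtr //; lra.
  have q0 : 0 <= q by apply: sqrtr_ge0.
  have tq : t < q by rewrite -ltr_sqr // q2; lra.
  have -> : s = q ^+ 2 - t ^+ 2 by rewrite q2 addrAC subrr add0r.
  rewrite hE -opprB -[X in - (_ - X)]/(uscal A _).
  have -> : uscal A (q ^+ 2)%:C%C = uscal A q%:C%C * uscal A q%:C%C.
    by rewrite expr2 !rmorphM.
  rewrite -mulr_subl_addl; last by rewrite /GRing.comm uscalC.
  apply/uinvertibleN/uinvertibleM; first by apply: cinv; rewrite ger0_norm.
  rewrite -[uscal A _]opprK uscalrN.
  by apply: cinv; rewrite normrN ger0_norm.
have r2t2 : 0 < r ^+ 2 - t ^+ 2 by rewrite subr_gt0 ltr_sqr ?nnegrE // ltW.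
have [b [bs bc]] := has_sqrt_shift hs hinv r2t2; rewrite hE => bb.
(* [d = i b] satisfies [d* = - d] and commutes with [c], so [c + d] and [c - d] are both bounded by
   [r]; [c] is their mean. *)
pose d := uscal A 'i%C * b.
have ds : ustar d = - d.
  rewrite ustarM bs ustar_scal -uscalC -mulNr -rmorphN; congr (uscal A _ * b).
  by apply/eqP; rewrite eq_complex /= oppr0 !eqxx.
have cd : GRing.comm c d.
  by apply: commrM; [rewrite /GRing.comm uscalC | apply: bc].
have dd : d * d = - (b * b).
  rewrite /d mulrA -(mulrA _ b) -uscalC mulrA -rmorphM -mulrA -expr2 sqr_i.
  by rewrite rmorphN1 mulN1r.
have rE : c * c - d * d = uscal A (r ^+ 2)%:C%C by rewrite dd opprK bb addrC subrK.
have u1 : ubound (c + d) r.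
  by apply: ubound_isometry (ltW r0) _; rewrite ustarD cs ds mulr_subl_addl.
have u2 : ubound (c - d) r.
  apply: ubound_isometry (ltW r0) _; rewrite ustarD ustarN cs ds opprK.
  rewrite -[d in X in X * _]opprK mulr_subl_addl ?mulrNN //.
  exact: commrN.
move=> x'; have : rnorm (uact (c + c) x') <= (r + r) * rnorm x'.
  have -> : c + c = (c + d) + (c - d) by rewrite addrACA subrr addr0.
  exact: uboundD.
have -> : c + c = uscal A 2%:R%:C%C * c.
  by rewrite -mulr2n !rmorph_nat mulr_natl.
rewrite uactM uact_scal rnormZr normr_nat; lra.
Qed.

Lemma cpositive_uinvertible (a : A) (z : R[i]) : cpositive a -> ~~ (0 <= z) ->
  uinvertible (uscal A z - uideal a).
Proof.
move=> [_ ap] z0; apply: contrapT => nz.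
have /ap : spectrum a z; last by apply/negP.
move=> [y [zy yz]]; apply: nz.
have -> : uscal A z - uideal a = (z, - a).
  by congr pair; rewrite /= ?subr0 ?sub0r.
by exists y.
Qed.

(** [ubound_real_spectrum] applies to [T - b]: for [x > T] the number [T - x] is negative, hence
    outside the spectrum of [b]; for [x < -T] it exceeds [T >= |b|] and Neumann's series applies. *)
Lemma cpositive_ubound (b : A) (T : R) : cpositive b -> rnorm b <= T ->
  ubound (uscal A T%:C%C - uideal b) T.
Proof.
move=> bpos bT; have T0 : 0 <= T := le_trans (rnorm_ge0 b) bT.
apply: ubound_real_spectrum => //.
  rewrite ustarD ustarN ustar_scal; congr (uscal A _ - _); first exact: conjc_real.
  by congr pair; [apply: rmorph0 | case: bpos].
move=> x; rewrite addrAC -rmorphB -rmorphB /=.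
have [x0|x0] := lerP 0 x; [rewrite ger0_norm // | rewrite ltr0_norm //] => Tx.
  apply: cpositive_uinvertible => //; rewrite ler0c -ltNge; lra.
have Tx0 : 0 < T - x by lra.
have -> : uideal b = uscal A (T - x)%:C%C * (uscal A ((T - x)^-1)%:C%C * uideal b).
  by rewrite mulrA -rmorphM -rmorphM /= mulfV ?gt_eqF // !rmorph1 mul1r.
rewrite -{1}[uscal A (T - x)%:C%C]mulr1 -mulrBr; apply: uinvertibleM.
  by apply: uinvertible_scal; rewrite fmorph_eq0 gt_eqF.
apply: neumann; rewrite unorm_scalM normcr gtr0_norm ?invr_gt0 //.
rewrite unorm_ideal mulrC ltr_pdivrMr //; lra.
Qed.

(** The powers of [v = u / y] decay like [q^n] with [q = C / y < 1], so [1 - v^n] is invertible for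
    some [n], and [1 - v] is a factor of it that commutes with the cofactor. *)
Lemma neumann_ubound u (C y : R) : ubound u C -> Normc.normc u.1 <= C -> C < y ->
  uinvertible (uscal A y%:C%C - u).
Proof.
move=> uC u1C Cy.
have C0 : 0 <= C := le_trans (normc_ge0 _) u1C.
have y0 : 0 < y by lra.
pose q : R := y^-1 * C; pose v := uscal A (y^-1)%:C%C * u.
have q0 : 0 <= q by rewrite mulr_ge0 // invr_ge0 ltW.
have q1 : q < 1 by rewrite /q mulrC ltr_pdivrMr // mul1r.
have vq : ubound v q.
  move=> x; rewrite uactM uact_scal rnormZr gtr0_norm ?invr_gt0 // /q -mulrA.
  by rewrite ler_wpM2l // invr_ge0 ltW.
have v1 : Normc.normc v.1 <= q.
  rewrite /v uscalM [X in Normc.normc X]/= Normc.normcM normcr gtr0_norm ?invr_gt0 //.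
  by rewrite ler_wpM2l // invr_ge0 ltW.
have vn1 n : Normc.normc (v ^+ n).1 <= q ^+ n.
  elim: n => [|n IH]; first by rewrite !expr0 Normc.normc1.
  rewrite !exprS (_ : (v * v ^+ n).1 = v.1 * (v ^+ n).1) //.
  by rewrite Normc.normcM ler_pM // normc_ge0.
(* One [q^n] comes from the scalar part, two from [ubound_ge] for the part in [A]. *)
have vn n : unorm (v ^+ n) <= 3 * q ^+ n.
  have qn0 : 0 <= q ^+ n by apply: exprn_ge0.
  have := vn1 n; have := ubound_ge erefl (uboundX n q0 vq) qn0; rewrite /unorm; lra.
have [n hn] : exists n, 3 * q ^+ n < 1.
  have [n hn] := @geometric_small R (3 * (1 - q)) q 1 ltac:(by rewrite q0) ltr01.
  exists n; move: hn; rewrite mulrAC mulfK // gt_eqF //; lra.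
have -> : uscal A y%:C%C - u = uscal A y%:C%C * (1 - v).
  by rewrite mulrBr mulr1 /v mulrA -rmorphM -rmorphM /= mulfV ?gt_eqF // !rmorph1 mul1r.
apply: uinvertibleM; first by apply: uinvertible_scal; rewrite fmorph_eq0 gt_eqF.
have : uinvertible (1 - v ^+ n) by apply: neumann; apply: le_lt_trans (vn n) hn.
rewrite -opprB subrX1 -mulNr opprB; apply: uinvertible_factor.
apply: commr_sum => i _; apply: commrX; apply: commr_sym.
by apply: commrB; [apply: commr1 | apply: commr_refl].
Qed.

(** [T + a = (T - b) + (a + b)] is bounded by [T + t], so [x - a = (T + x) - (T + a)] is invertible
    for [x > t]. Positivity of [a] settles negative [x], and [ubound_real_spectrum] applies to
    [a]. *)
Lemma cpositive_norm_le (a b : A) : cpositive a -> cpositive b ->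
  rnorm a <= rnorm (a + b).
Proof.
move=> apos bpos; set t := rnorm (a + b); set T := rnorm b.
have t0 : 0 <= t by apply: rnorm_ge0.
have T0 : 0 <= T by apply: rnorm_ge0.
have as_ : cstar a = a by case: apos.
have Ta : ubound (uscal A T%:C%C + uideal a) (T + t).
  have -> : uscal A T%:C%C + uideal a =
      (uscal A T%:C%C - uideal b) + uideal (a + b).
    by congr pair; rewrite /= ?subr0 ?addr0 // sub0r add0r addrCA addNr addr0.
  apply: uboundD; first exact: cpositive_ubound.
  by move=> x; rewrite uact_ideal rnormM.
suff aT : ubound (uideal a) t by exact: ubound_ideal.
apply: ubound_real_spectrum => //.
  by congr pair; [apply: rmorph0 | ].
move=> x; rewrite -opprB => tx; apply: uinvertibleN.
have [x0|x0] := lerP 0 x; last first.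
  by apply: cpositive_uinvertible => //; rewrite ler0c -ltNge.
have -> : uscal A x%:C%C - uideal a =
    uscal A (T + x)%:C%C - (uscal A T%:C%C + uideal a).
  by rewrite rmorphD rmorphD /= opprD addrACA subrr add0r.
move: tx; rewrite ger0_norm // => tx.
apply: neumann_ubound Ta _ _; last by lra.
by rewrite [_.1](addr0 T%:C%C) normcr ger0_norm //; lra.
Qed.

End PositiveElements.

(** * Operators on Hilbert modules *)

Section HilbertModules.
Context (R : realType) (A : cstarAlgType R).
Implicit Types H K : hilbertModType A.

Lemma rnorm_inner H (x : H) : rnorm (inner x x) = rnorm x ^+ 2.
Proof. by apply: complexI; rewrite rmorphXn /= -!rnormE inner_norm. Qed.

Lemma innerZl H (z : R[i]) (x y : H) : inner (z *: x) y = z^* *: inner x y :> A.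
Proof. by rewrite inner_star innerZr cstarZ -inner_star. Qed.

Lemma innerZrr H (r : R) (x y : H) :
  inner (r%:C%C *: x) y = r%:C%C *: inner x y :> A.
Proof. by rewrite innerZl; congr (_ *: _); apply: conjc_real. Qed.

Lemma inner_sum_norm_le H K (x : H) (y : K) :
  rnorm x ^+ 2 <= rnorm (inner x x + inner y y : A).
Proof. by rewrite -rnorm_inner; apply: cpositive_norm_le; apply: inner_pos. Qed.

Lemma rnorm_inner_sym H (x y : H) : rnorm (inner x y + inner y x : A) <=
  (rnorm x + rnorm y) ^+ 2 + (rnorm x ^+ 2 + rnorm y ^+ 2).
Proof.
have -> : inner x y + inner y x =
    inner (x + y) (x + y) - (inner x x + inner y y) :> A.
  by rewrite innerDl !innerDr (addrC (inner y x)) addrACA [RHS]addrC addKr.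
apply: le_trans (rnormD _ _) _; rewrite rnormN; apply: lerD.
  by rewrite rnorm_inner ler_sqr ?nnegrE ?addr_ge0 ?rnorm_ge0 ?rnormD.
by rewrite -!rnorm_inner rnormD.
Qed.

Lemma normci : Normc.normc ('i%C : R[i]) = 1.
Proof. by rewrite /= expr0n expr1n add0r sqrtr1. Qed.

(* Cauchy-Schwarz up to a constant, by polarization. *)
Lemma rnorm_inner_le H (x y : H) : rnorm (inner x y : A) <= 6 * rnorm x * rnorm y.
Proof.
(* [rnorm_inner_sym] gives [(1 + 1)^2 + 2 = 6] for [<u,v> + <v,u>] and, with [i v] for [v], for
   [<u,v> - <v,u>]; the mean of the two is [<u,v>]. *)
have unit_case (u v : H) : rnorm u = 1 -> rnorm v = 1 -> rnorm (inner u v : A) <= 6.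
  move=> u1 v1; have iv1 : rnorm ('i%C *: v) = 1 by rewrite rnormZ normci mul1r.
  have := rnorm_inner_sym u v; have := rnorm_inner_sym u ('i%C *: v).
  rewrite innerZr innerZl u1 v1 iv1.
  have -> : 'i%C *: inner u v + ('i%C)^* *: inner v u =
      'i%C *: (inner u v - inner v u) :> A.
    rewrite scalerBr -scaleNr; congr (_ + _ *: _).
    by apply/eqP; rewrite eq_complex /= oppr0 !eqxx.
  rewrite rnormZ normci mul1r.
  have := rnormD (inner u v - inner v u : A) (inner u v + inner v u).
  rewrite addrACA addNr addr0 -mulr2n -scaler_nat.
  rewrite -(rmorph_nat (real_complex R)) rnormZr normr_nat; lra.
have [x0|x0] := eqVneq (rnorm x) 0.
  by rewrite (rnorm_eq0 x0) inner0l !rnorm0 mulr0 mul0r.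
have [y0|y0] := eqVneq (rnorm y) 0.
  by rewrite (rnorm_eq0 y0) inner0r !rnorm0 mulr0.
have n1 (u : H) : rnorm u != 0 -> rnorm (((rnorm u)^-1)%:C%C *: u) = 1.
  by move=> u0; rewrite rnormZr ger0_norm ?invr_ge0 ?rnorm_ge0 // mulVf.
have xp : 0 < rnorm x by rewrite lt_def x0 rnorm_ge0.
have yp : 0 < rnorm y by rewrite lt_def y0 rnorm_ge0.
have := unit_case _ _ (n1 x x0) (n1 y y0).
rewrite innerZrr innerZr !rnormZr !ger0_norm ?invr_ge0 ?rnorm_ge0 //.
by rewrite mulrC ler_pdivrMr // mulrC ler_pdivrMr // mulrAC.
Qed.

Section Adjointable.
Context (H K : hilbertModType A) (T : 'L(H, K)).

Lemma adj_inner (x : H) (y : K) : inner (aadj T y) x = inner y (T x) :> A.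
Proof. by rewrite inner_star -aadjP -inner_star. Qed.

Lemma aopD (x x' : H) : T (x + x') = T x + T x'.
Proof. by apply: inner_inj => y; rewrite innerDr -!adj_inner innerDr. Qed.

Lemma aopZ (z : R[i]) (x : H) : T (z *: x) = z *: T x.
Proof. by apply: inner_inj => y; rewrite innerZr -!adj_inner innerZr. Qed.

Lemma aopN (x : H) : T (- x) = - T x.
Proof. by rewrite -scaleN1r aopZ scaleN1r. Qed.

Lemma aop0 : T 0 = 0.
Proof. by rewrite -(scale0r (0 : H)) aopZ scale0r. Qed.

End Adjointable.

Lemma aadj0 H K (T : 'L(H, K)) : aadj T 0 = 0.
Proof. exact: (aop0 (adjoint T)). Qed.

Lemma aadjZ H K (T : 'L(H, K)) (z : R[i]) (y : K) : aadj T (z *: y) = z *: aadj T y.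
Proof. exact: (aopZ (adjoint T)). Qed.

(** [2 <g, xi> = <g, x + xi> - <g, x - xi>], so one of the two signs works whatever [x] is: earlier
    terms of the hump series cannot cancel the new one. *)
Lemma sign_choice H (g x xi : H) : exists s : R,
  `|s| = 1 /\ rnorm (inner g xi : A) <= rnorm (inner g (x + s%:C%C *: xi) : A).
Proof.
set m := rnorm (inner g xi : A).
have dbl : 2 * m <= rnorm (inner g (x + xi) : A) + rnorm (inner g (x - xi) : A).
  have := rnormD (inner g (x + xi) : A) (- inner g (x - xi)); rewrite rnormN.
  rewrite -innerNr -innerDr opprB [x + xi + _]addrC addrA subrK.
  rewrite innerDr -mulr2n -scaler_nat -(rmorph_nat (real_complex R)) rnormZr normr_nat.
  by [].
have [h|h] := lerP m (rnorm (inner g (x + xi) : A)).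
  by exists 1; rewrite normr1 rmorph1 scale1r.
by exists (-1); rewrite normrN1 rmorphN1 scaleN1r; split => //; lra.
Qed.

(* Uniform boundedness by a gliding hump: otherwise some series of small vectors
   [10^-n T* y_n / |T* y_n|], with suitable signs, has a sum [l] for which the
   numbers [<y_n, T l>] are unbounded. *)
Lemma aadj_bounded H K (T : 'L(H, K)) :
  exists2 C : R, 0 <= C & forall y, rnorm (aadj T y) <= C * rnorm y.
Proof.
apply: contrapT => unb.
have big (C : R) : exists y, rnorm y = 1 /\ `|C| < rnorm (aadj T y).
  apply: contrapT => small; apply: unb; exists `|C| => // y.
  rewrite leNgt; apply/negP => Cy; apply: small.
  have [y0|y0] := eqVneq (rnorm y) 0.
    by move: Cy; rewrite (rnorm_eq0 y0) aadj0 !rnorm0 mulr0 ltxx.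
  have yp : 0 < rnorm y by rewrite lt_def y0 rnorm_ge0.
  exists (((rnorm y)^-1)%:C%C *: y); rewrite aadjZ !rnormZr.
  rewrite ger0_norm ?invr_ge0 ?rnorm_ge0 // mulVf //; split=> //.
  by rewrite mulrC ltr_pdivlMr.
(* The factor [10^n] offsets the scaling of the term with index [n] in the series and leaves growth
   [n]. *)
pose y n := xget 0 [set y | rnorm y = 1 /\ `|10 ^+ n * n%:R : R| < rnorm (aadj T y)].
have yP n : rnorm (y n) = 1 /\ 10 ^+ n * n%:R < rnorm (aadj T (y n)).
  have := xgetPex 0 (big (10 ^+ n * n%:R)); rewrite -/(y n) => -[-> h].
  by split=> //; apply: le_lt_trans (ler_norm _) h.
pose g n := aadj T (y n).
have g0 n : 0 < rnorm (g n).
  by apply: le_lt_trans (yP n).2; rewrite mulr_ge0 // exprn_ge0.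
pose xi n := (10^-1 ^+ n / rnorm (g n))%:C%C *: g n.
have t0 n : 0 < 10^-1 ^+ n :> R by rewrite exprn_gt0 // invr_gt0.
have xi_norm n : rnorm (xi n) = 10^-1 ^+ n.
  by rewrite rnormZr ger0_norm ?divr_ge0 ?(ltW (t0 n)) ?rnorm_ge0 // divfK // gt_eqF.
have xi_inner n : rnorm (inner (g n) (xi n) : A) = 10^-1 ^+ n * rnorm (g n).
  rewrite innerZr rnormZr ger0_norm ?divr_ge0 ?(ltW (t0 n)) ?rnorm_ge0 //.
  by rewrite rnorm_inner expr2 mulrA divfK // gt_eqF.
pose s n (x : H) : R := xget 0 [set s : R | `|s| = 1 /\
  rnorm (inner (g n) (xi n) : A) <= rnorm (inner (g n) (x + s%:C%C *: xi n) : A)].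
have sP n x : `|s n x| = 1 /\ rnorm (inner (g n) (xi n) : A) <=
    rnorm (inner (g n) (x + (s n x)%:C%C *: xi n) : A).
  exact: (xgetPex 0 (sign_choice (g n) x (xi n))).
pose u := fix u n := if n is m.+1 then u m + (s m (u m))%:C%C *: xi m else 0 : H.
have step n : rnorm (u n.+1 - u n) <= 1 * 10^-1 ^+ n.
  by rewrite /= addrAC subrr add0r rnormZr (sP n (u n)).1 !mul1r xi_norm.
have q01 : (0 <= 10^-1 :> R) && (10^-1 < 1 :> R) by apply/andP; split; lra.
have [l hl] := geometric_limit q01 step.
(* The partial sum [u n.+1] pairs with [g n] to at least [10^-n |g n|], and the tail, of norm at
   most [10^-n / 9], to at most [6 / 9] of that. So [n / 3 < |<g n, l>| = |<y n, T l>| <= 6 |T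
   l|]. *)
have bound n : n%:R <= 18 * rnorm (T l).
  have := hl n.+1; rewrite mul1r exprS => hln.
  have := (sP n (u n)).2; rewrite -/(u n.+1) xi_inner => hs.
  have h1 := rnorm_inner_le (y n) (T l); rewrite (yP n).1 -adj_inner -/(g n) in h1.
  have h2 := rnorm_inner_le (g n) (l - u n.+1).
  have h3 := rnormD (inner (g n) l : A) (- inner (g n) (l - u n.+1)).
  rewrite rnormN -[in X in X <= _]innerNr -innerDr opprB addrCA subrr addr0 in h3.
  have nlt : n%:R < 10^-1 ^+ n * rnorm (g n).
    by rewrite exprVn mulrC ltr_pdivlMr ?exprn_gt0 // mulrC; exact: (yP n).2.
  have h4 : rnorm (g n) * rnorm (l - u n.+1) <= rnorm (g n) * (10^-1 ^+ n / 9).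
    apply: ler_wpM2l; first exact: rnorm_ge0.
    apply: le_trans hln _; rewrite (_ : 1 - 10^-1 = 9 / 10 :> R); last by lra.
    by rewrite invf_div; lra.
  lra.
have := archi_boundP (mulr_ge0 (ler0n R 18) (rnorm_ge0 (T l))).
by rewrite ltNge bound.
Qed.

(** * Invertibility of [1 + T* T] by the continuity method *)

Section Coercive.
Context (H K : hilbertModType A) (T : 'L(H, K)).

Let P (x : H) : H := aadj T (T x).

Let PD (x x' : H) : P (x + x') = P x + P x'.
Proof. by rewrite /P aopD; exact: (aopD (adjoint T)). Qed.

Let PN (x : H) : P (- x) = - P x.
Proof. by rewrite /P aopN; exact: (aopN (adjoint T)). Qed.

(** [|x|^2 <= |<x,x> + t <Tx,Tx>| = |<x, x + t P x>|], and [6] is the constant of [rnorm_inner_le].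
    The bound is uniform in [t]. *)
Lemma coercive_shift (t : R) (x : H) : 0 <= t ->
  rnorm x <= 6 * rnorm (x + t%:C%C *: P x).
Proof.
move=> t0; have [x0|x0] := eqVneq (rnorm x) 0.
  by rewrite x0 mulr_ge0 ?rnorm_ge0.
have xp : 0 < rnorm x by rewrite lt_def x0 rnorm_ge0.
rewrite -(ler_pM2l xp) -expr2 mulrA (mulrC (rnorm x)).
apply: le_trans (rnorm_inner_le _ _).
apply: le_trans (inner_sum_norm_le x ((Num.sqrt t)%:C%C *: T x)) _.
rewrite innerZrr innerZr scalerA -rmorphM /= -expr2 sqr_sqrtr //.
by rewrite innerDr innerZr aadjP.
Qed.

Let solvable (t : R) := forall y, exists x, x + t%:C%C *: P x = y.

(** A solution at [t'] is a fixed point of [x |-> s (y - (t' - t) P x)], with [s] a solution map at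
    [t]. By [coercive_shift], [s] has Lipschitz constant [6], so the smallness hypothesis gives the
    contraction factor [1 / 2]. *)
Lemma solvable_shift (t t' D : R) : 0 <= t ->
  (forall x, rnorm (P x) <= D * rnorm x) -> `|t' - t| * (12 * D) <= 1 ->
  solvable t -> solvable t'.
Proof.
move=> t0 PDn tt' solv y.
have [s sE] := choice solv.
have sB v w : rnorm (s v - s w) <= 6 * rnorm (v - w).
  apply: le_trans (coercive_shift (s v - s w) t0) _.
  by rewrite PD PN scalerBr addrACA -opprD !sE.
pose F x := s (y - (t' - t)%:C%C *: P x).
have q01 : (0 <= 2^-1 :> R) && (2^-1 < 1 :> R) by apply/andP; split; lra.
have [||||x _ xE] := @contraction_fixpoint R H setT F _ q01.
- by [].
- by exists 0.
- by [].
- move=> x x' _ _; apply: le_trans (sB _ _) _.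
  rewrite opprD opprK addrACA subrr add0r addrC -scalerBr -PN -PD rnormZr.
  have := PDn (x' - x); rewrite (rnormB x') => h.
  have := ler_wpM2l (normr_ge0 (t' - t)) h.
  have : `|t' - t| * (12 * D) * rnorm (x - x') <= 1 * rnorm (x - x').
    by rewrite ler_wpM2r ?rnorm_ge0.
  lra.
have h := sE (y - (t' - t)%:C%C *: P x); rewrite -/(F x) xE in h.
exists x; rewrite -[X in X%:C%C](subrK t) addrC.
by rewrite rmorphD scalerDl (addrC ((t' - t)%:C%C *: _)) addrC addrA h subrK.
Qed.

(** From [t = 0] the value [t = 1] is reached in [N] steps of length [1 / N], the admissible length
    being independent of [t]. Coercivity gives injectivity, and the inverse [V] is its own adjoint
    because [1 + P] is symmetric. *)
Lemma invertible_1DadjM : invertible (idop H + adjoint T \oL T).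
Proof.
have [C1 C10 T1] := aadj_bounded T; have [C2 C20 T2] := aadj_bounded (adjoint T).
pose D := C1 * C2; have D0 : 0 <= D by rewrite mulr_ge0.
have PDn x : rnorm (P x) <= D * rnorm x.
  by apply: le_trans (T1 _) _; rewrite -mulrA ler_wpM2l //; exact: T2.
have D12 : 0 <= 12 * D by rewrite mulr_ge0.
pose N := Num.bound (12 * D); have hN : 12 * D < N%:R by apply: archi_boundP.
have N0 : 0 < N%:R :> R by apply: le_lt_trans hN.
have solv k : solvable (k%:R / N%:R).
  elim: k => [|k IH]; first by move=> y; exists y; rewrite mul0r scale0r addr0.
  apply: (@solvable_shift (k%:R / N%:R) _ D) => //.
  rewrite -mulrBl -natr1 addrAC subrr add0r mul1r ger0_norm ?invr_ge0 ?(ltW N0) //.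
  by rewrite mulrC ler_pdivrMr // mul1r ltW.
have solv1 y : exists x, x + P x = y.
  have [x] := solv N y.
  by rewrite divff ?gt_eqF // rmorph1 scale1r; exists x.
have [V VE] := choice solv1.
have inj x x' : x + P x = x' + P x' -> x = x'.
  move=> e; apply/eqP; rewrite -subr_eq0; apply/eqP/rnorm_eq0.
  have := coercive_shift (x - x') (ler01 : 0 <= 1 :> R).
  rewrite rmorph1 scale1r PD PN addrACA -opprD e subrr rnorm0 mulr0 => h.
  by apply/eqP; rewrite eq_le h rnorm_ge0.
have symP x x' : inner (x + P x) x' = inner x (x' + P x') :> A.
  by rewrite innerDl innerDr /P adj_inner -aadjP.
have Vadj x y : inner (V x) y = inner x (V y) :> A.
  by rewrite -{1}(VE y) -symP VE.
exists (Adjointable Vadj); split; apply: adjointable_ext => x; last exact: VE.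
by apply: inj; exact: VE.
Qed.

End Coercive.

End HilbertModules.

(** * Orthogonal projections and weighted idempotents *)

Section MoorePenrose.
Context (R : realType) (A : cstarAlgType R).
Implicit Types H K : hilbertModType A.

Lemma adjointK H K (T : 'L(H, K)) : adjoint (adjoint T) = T.
Proof. exact: adjointable_ext. Qed.

Lemma adjoint_comp H K G (S : 'L(K, G)) (T : 'L(H, K)) :
  adjoint (S \oL T) = adjoint T \oL adjoint S.
Proof. exact: adjointable_ext. Qed.

Lemma adjointD H K (S T : 'L(H, K)) : adjoint (S + T) = adjoint S + adjoint T.
Proof. exact: adjointable_ext. Qed.

Lemma adjointN H K (T : 'L(H, K)) : adjoint (- T) = - adjoint T.
Proof. exact: adjointable_ext. Qed.

Lemma adjoint_id H : adjoint (idop H) = idop H.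
Proof. exact: adjointable_ext. Qed.

Lemma ocompA H K G L (U : 'L(G, L)) (S : 'L(K, G)) (T : 'L(H, K)) :
  U \oL (S \oL T) = U \oL S \oL T.
Proof. exact: adjointable_ext. Qed.

Lemma ocompDl H K G (S S' : 'L(K, G)) (T : 'L(H, K)) :
  (S + S') \oL T = S \oL T + S' \oL T.
Proof. exact: adjointable_ext. Qed.

Lemma ocompDr H K G (S : 'L(K, G)) (T T' : 'L(H, K)) :
  S \oL (T + T') = S \oL T + S \oL T'.
Proof. by apply: adjointable_ext => x /=; rewrite aopD. Qed.

Lemma ocompNl H K G (S : 'L(K, G)) (T : 'L(H, K)) : (- S) \oL T = - (S \oL T).
Proof. exact: adjointable_ext. Qed.

Lemma ocompNr H K G (S : 'L(K, G)) (T : 'L(H, K)) : S \oL (- T) = - (S \oL T).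
Proof. by apply: adjointable_ext => x /=; rewrite aopN. Qed.

Lemma ocomp1l H K (T : 'L(H, K)) : idop K \oL T = T.
Proof. exact: adjointable_ext. Qed.

Lemma ocomp1r H K (T : 'L(H, K)) : T \oL idop H = T.
Proof. exact: adjointable_ext. Qed.

Lemma opinvP H (T : 'L(H)) : invertible T -> is_inverse T (opinv T).
Proof. by move=> [S TS]; apply: (xgetI 0 TS). Qed.

Lemma is_inverse_adjoint H (T S : 'L(H)) :
  is_inverse T S -> is_inverse (adjoint T) (adjoint S).
Proof.
by move=> [ST TS]; split; rewrite -adjoint_comp ?ST ?TS adjoint_id.
Qed.

Lemma is_inverse_uniq H (T S S' : 'L(H)) : is_inverse T S -> is_inverse T S' -> S = S'.
Proof.
move=> [ST TS] [ST' TS'].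
by rewrite -[LHS]ocomp1r -TS' ocompA ST ocomp1l.
Qed.

Lemma is_inverse_sa H (T S : 'L(H)) : adjoint T = T -> is_inverse T S -> adjoint S = S.
Proof.
move=> Ts TS; apply: (is_inverse_uniq _ TS).
by have := is_inverse_adjoint TS; rewrite Ts.
Qed.

Lemma is_inverse_comm H (z w p : 'L(H)) :
  is_inverse z w -> p \oL z = z \oL p -> p \oL w = w \oL p.
Proof.
move=> [wz zw] pz.
by rewrite -[LHS]ocomp1l -wz -!ocompA (ocompA z) -pz -ocompA zw ocomp1r.
Qed.

(* Let [q] be the adjoint of [p]. Then [z = 1 + (q - p)(p - q)] commutes with [p]
   and [q], and [q p z^-1] is the orthogonal projection with the same kernel as [p]. *)
Lemma idempotent_projection H (p : 'L(H)) : p \oL p = p ->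
  exists E : 'L(H), [/\ adjoint E = E, E \oL p = E & p \oL E = p].
Proof.
move=> pp; set q := adjoint p.
have qq : q \oL q = q by rewrite -adjoint_comp pp.
have qa : adjoint q = p by apply: adjointK.
have [w zw] := invertible_1DadjM (p - q).
set z := idop H + _ in zw.
have zE : z = idop H + (q \oL p - q) + (p \oL q - p).
  rewrite /z adjointD adjointN -/q qa !ocompDl !ocompDr !ocompNl !ocompNr pp qq.
  by rewrite opprK -[RHS]addrA; congr (_ + (_ + _)); rewrite addrC.
have za : adjoint z = z.
  rewrite zE !adjointD !adjointN !adjoint_comp qa -/q adjoint_id.
  rewrite -!addrA; congr (_ + (_ + _)); rewrite [LHS]addrCA [RHS]addrCA.
  by rewrite (addrC (- p)).
have wa := is_inverse_sa za zw.
(* The terms of [p z] and of [z p] cancel down to the same [p q p]; hence [p] commutes with [z], and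
   [p q p w = p]. *)
have pz : p \oL z = p \oL q \oL p.
  rewrite zE !ocompDr !ocompNr ocomp1r !ocompA pp.
  by rewrite (addrC p) -addrA (addrCA p) subrr addr0 subrK.
have zp : z \oL p = p \oL q \oL p.
  rewrite zE !ocompDl !ocompNl ocomp1l -[q \oL p \oL p]ocompA pp subrr addr0.
  by rewrite addrC subrK.
have wp : p \oL w = w \oL p by apply: is_inverse_comm zw _; rewrite pz zp.
have wq : q \oL w = w \oL q.
  apply: is_inverse_comm zw _; have : adjoint (p \oL z) = adjoint (z \oL p).
    by rewrite pz zp.
  by rewrite !adjoint_comp za => ->.
case: zw => wz zw.
exists (q \oL p \oL w); split.
- by rewrite !adjoint_comp wa qa -/q ocompA -wq -ocompA -wp ocompA.
- by rewrite -ocompA -wp !ocompA -(ocompA q p p) pp.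
- by rewrite !ocompA -pz -ocompA zw ocomp1r.
Qed.

(** Let [E] be the orthogonal projection with the kernel of [X T]. Then [T (E X) = T X] and
    [(E X) T = E], so only the second symmetry changes its weight. *)
Lemma wmp_exists_left H K (M : 'L(K)) (N : 'L(H)) (T : 'L(H, K)) :
  wmp_exists M N T -> wmp_exists M (idop H) T.
Proof.
move=> [X [TXT XTX MTX _]].
have pp : (X \oL T) \oL (X \oL T) = X \oL T by rewrite ocompA XTX.
have [E [Ea Ep pE]] := idempotent_projection pp.
have TE : T \oL E = T by rewrite -{1}TXT -ocompA -ocompA (ocompA X) pE ocompA TXT.
have EE : E \oL E = E by rewrite -{1}Ep -ocompA pE Ep.
exists (E \oL X); split.
- by rewrite ocompA TE.
- by rewrite -(ocompA E X T) Ep ocompA EE.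
- by rewrite -!ocompA (ocompA T E) TE ocompA.
- by rewrite ocomp1l -ocompA Ep.
Qed.

(** Here [E] is the orthogonal projection onto the range of [T X], obtained from the adjoint
    idempotent; [T (X E) = E] and [(X E) T = X T]. *)
Lemma wmp_exists_right H K (M : 'L(K)) (N : 'L(H)) (T : 'L(H, K)) :
  wmp_exists M N T -> wmp_exists (idop K) N T.
Proof.
move=> [X [TXT XTX _ NXT]].
have qq : adjoint (T \oL X) \oL adjoint (T \oL X) = adjoint (T \oL X).
  by rewrite -adjoint_comp ocompA TXT.
have [E [Ea Eq qE]] := idempotent_projection qq.
have XE : T \oL X \oL E = E.
  by have := congr1 (@adjoint R A K K) Eq; rewrite adjoint_comp adjointK Ea.
have ET : E \oL T = T.
  have : E \oL (T \oL X) = T \oL X.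
    by have := congr1 (@adjoint R A K K) qE; rewrite adjoint_comp adjointK Ea.
  by move=> EX; rewrite -{1}TXT ocompA EX TXT.
exists (X \oL E); split.
- by rewrite -!ocompA ET ocompA TXT.
- by rewrite -!ocompA (ocompA E T) ET (ocompA T) XE.
- by rewrite ocomp1l ocompA XE.
- by rewrite -!ocompA ET ocompA.
Qed.

Lemma ocomp0l H K G (T : 'L(H, K)) : (0 : 'L(K, G)) \oL T = 0.
Proof. exact: adjointable_ext. Qed.

Lemma ocomp0r H K G (S : 'L(K, G)) : S \oL (0 : 'L(H, K)) = 0.
Proof. by apply: adjointable_ext => x /=; rewrite aop0. Qed.

Lemma selfadjoint_comp_swap H (M q : 'L(H)) : adjoint M = M ->
  adjoint (M \oL q) = M \oL q -> adjoint q \oL M = M \oL q.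
Proof. by move=> Ma <-; rewrite adjoint_comp Ma. Qed.

(** [M q = M r q = r* M q = r* q* M = (q r)* M = r* M = M r], and [M] cancels. The kernel version is
    the same chain starting from [N p = N p r]. *)
Lemma weighted_idempotent_range_uniq H (M M' q r : 'L(H)) :
  adjoint M = M -> M' \oL M = idop H ->
  adjoint (M \oL q) = M \oL q -> adjoint (M \oL r) = M \oL r ->
  r \oL q = q -> q \oL r = r -> q = r.
Proof.
move=> Ma M'M Mq Mr rq qr; rewrite -[q]ocomp1l -[r]ocomp1l -M'M -!ocompA.
congr (_ \oL _); rewrite -{1}rq ocompA -(selfadjoint_comp_swap Ma Mr) -ocompA.
by rewrite -(selfadjoint_comp_swap Ma Mq) ocompA -adjoint_comp qr.
Qed.

Lemma weighted_idempotent_kernel_uniq H (N N' p r : 'L(H)) :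
  adjoint N = N -> N' \oL N = idop H ->
  adjoint (N \oL p) = N \oL p -> adjoint (N \oL r) = N \oL r ->
  p \oL r = p -> r \oL p = r -> p = r.
Proof.
move=> Na N'N Np Nr pr rp; rewrite -[p]ocomp1l -[r]ocomp1l -N'N -!ocompA.
congr (_ \oL _); rewrite -{1}pr ocompA -(selfadjoint_comp_swap Na Np) -ocompA.
by rewrite -(selfadjoint_comp_swap Na Nr) ocompA -adjoint_comp rp.
Qed.

(** [T X] and [T Y] are [M]-selfadjoint idempotents with the same range, [X T] and [Y T] are
    [N]-selfadjoint with the same kernel. So they agree in pairs, and
    [X = X T X = X T Y = Y T Y = Y]. *)
Lemma is_wmp_uniq H K (M : 'L(K)) (N : 'L(H)) (T : 'L(H, K)) (X Y : 'L(K, H)) :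
  weight M -> weight N -> is_wmp M N T X -> is_wmp M N T Y -> X = Y.
Proof.
move=> [Ma [M' [M'M _]]] [Na [N' [N'N _]]] [TXT XTX MX NX] [TYT YTY MY NY].
have TXY : T \oL X = T \oL Y.
  apply: (weighted_idempotent_range_uniq Ma M'M); rewrite ?ocompA //.
    by rewrite TYT.
  by rewrite TXT.
have XYT : X \oL T = Y \oL T.
  apply: (weighted_idempotent_kernel_uniq Na N'N); rewrite ?ocompA //.
    by rewrite -!ocompA (ocompA T) TYT.
  by rewrite -!ocompA (ocompA T) TXT.
by rewrite -XTX -ocompA TXY ocompA XYT YTY.
Qed.

(* [E] is an [N]-selfadjoint idempotent with the same kernel as [P]. *)
Lemma Rop_inverse H (P E N N' : 'L(H)) : adjoint P = P -> P \oL P = P ->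
  P \oL E = P -> E \oL P = E -> adjoint N = N -> adjoint (N \oL E) = N \oL E ->
  is_inverse N N' ->
  is_inverse (P + (idop H - P) \oL N) (E + (idop H - E) \oL N' \oL (idop H - P)).
Proof.
move=> Pa PP PE EP Na NE [N'N NN'].
set F := adjoint E; set Z := idop H - P.
have FN : F \oL N = N \oL E := selfadjoint_comp_swap Na NE.
have FP : F \oL P = P by rewrite -{1}Pa -adjoint_comp PE.
have PF : P \oL F = F by rewrite -{1}Pa -adjoint_comp EP.
have EN' : (idop H - E) \oL N' = N' \oL (idop H - F).
  rewrite ocompDl ocompDr ocomp1l ocomp1r ocompNl ocompNr; congr (_ - _).
  by rewrite -[LHS]ocomp1l -N'N -!ocompA (ocompA N) -FN -ocompA NN' ocomp1r.
have NE' : N \oL (idop H - E) = (idop H - F) \oL N.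
  by rewrite ocompDl ocompDr ocomp1l ocomp1r ocompNl ocompNr FN.
have ZP : Z \oL P = 0 by rewrite /Z ocompDl ocompNl ocomp1l PP subrr.
have ZZ : Z \oL Z = Z by rewrite {2}/Z ocompDr ocompNr ocomp1r ZP subr0.
have EZ : E \oL Z = 0 by rewrite /Z ocompDr ocompNr ocomp1r EP subrr.
have ZF : Z \oL F = 0 by rewrite /Z ocompDl ocompNl ocomp1l PF subrr.
have PE' : P \oL (idop H - E) = 0 by rewrite ocompDr ocompNr ocomp1r PE subrr.
have FZ : (idop H - F) \oL Z = idop H - F.
  by rewrite /Z ocompDr ocompNr ocomp1r ocompDl ocompNl ocomp1l FP subrr subr0.
have PZ : P + Z = idop H by rewrite addrC subrK.
(* Of the four terms of each product two vanish, by [E Z = 0] and [Z P = 0], respectively by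
   [P (1 - E) = 0] and [Z F = 0]. Across the weight [1 - E] becomes [1 - F], so the last term is
   [1 - E], respectively [Z]. *)
clearbody Z; split; rewrite ocompDl !ocompDr.
  rewrite EP (ocompA E) EZ ocomp0l addr0 -[X in _ + (X + _)]ocompA ZP ocomp0r add0r.
  rewrite -[X in _ + X]ocompA (ocompA Z Z) ZZ EN' -ocompA (ocompA _ Z) FZ -NE'.
  by rewrite ocompA N'N ocomp1l addrC subrK.
rewrite PE !ocompA PE' !ocomp0l addr0 -(ocompA Z N E) -FN ocompA ZF ocomp0l add0r.
rewrite -(ocompA Z N) NE' ocompA -(ocompA _ N N') NN' ocomp1r -ocompA FZ.
by rewrite ocompDr ocompNr ocomp1r ZF subr0.
Qed.

End MoorePenrose.

(** * Weighted Moore-Penrose inverses *)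

Section WeightedInverse.
Context (R : realType) (A : cstarAlgType R).
Implicit Types H K : hilbertModType A.

Lemma mpP H K (T : 'L(H, K)) : mp_exists T ->
  [/\ T \oL mp T \oL T = T, mp T \oL T \oL mp T = mp T,
      adjoint (T \oL mp T) = T \oL mp T & adjoint (mp T \oL T) = mp T \oL T].
Proof.
move=> [X TX]; have [TXT XTX] : is_wmp (idop K) (idop H) T (mp T) := xgetI 0 TX.
by rewrite !ocomp1l.
Qed.

(** [Y T Z] combines both symmetries: [T (Y T Z) = T Z] and [(Y T Z) T = Y T]. *)
Lemma mp_exists_of_weighted H K (M : 'L(K)) (N : 'L(H)) (T : 'L(H, K)) :
  wmp_exists M (idop H) T -> wmp_exists (idop K) N T -> mp_exists T.
Proof.
move=> [Y [TYT YTY _ YT]] [Z [TZT ZTZ TZ _]]; rewrite !ocomp1l in YT TZ.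
exists (Y \oL T \oL Z); split; rewrite ?ocomp1l.
- by rewrite !ocompA TYT TZT.
- have TZTS (S : 'L(K, H)) : T \oL (Z \oL (T \oL S)) = T \oL S by rewrite !ocompA TZT.
  have TYTS (S : 'L(K, H)) : T \oL (Y \oL (T \oL S)) = T \oL S by rewrite !ocompA TYT.
  by rewrite -!ocompA TZTS TYTS.
- by rewrite !ocompA TYT.
- by rewrite -!ocompA (ocompA T Z) TZT.
Qed.

Lemma invertible_Rop H K (N : 'L(H)) (T : 'L(H, K)) :
  weight N -> mp_exists T -> wmp_exists (idop K) N T -> invertible (Rop T N).
Proof.
move=> [Na [N' NN']] /mpP [TXT XTX _ XT] [Z [TZT ZTZ _ NZT]].
eexists; apply: (@Rop_inverse _ _ _ _ (Z \oL T)) => //.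
- by rewrite ocompA XTX.
- by rewrite -!ocompA (ocompA T Z) TZT.
- by rewrite -!ocompA (ocompA T (mp T)) TXT.
- by rewrite ocompA.
- exact: NN'.
Qed.

(* [Lop T B] is the adjoint of an operator of the shape of [Rop]. *)
Lemma invertible_Lop H K (M : 'L(K)) (T : 'L(H, K)) :
  weight M -> mp_exists T -> wmp_exists M (idop H) T -> invertible (Lop T (opinv M)).
Proof.
move=> [Ma Minv] /mpP [TXT XTX TX _] [Y [TYT YTY MTY _]].
have MM' := opinvP Minv; set M' := opinv M in MM' *.
have M'a : adjoint M' = M' := is_inverse_sa Ma MM'.
have [M'M MM'1] := MM'.
have TYM : adjoint (T \oL Y) \oL M = M \oL (T \oL Y).
  by apply: selfadjoint_comp_swap; rewrite // ocompA.
have -> : Lop T M' =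
    adjoint (T \oL mp T + (idop K - T \oL mp T) \oL M').
  by rewrite adjointD TX adjoint_comp adjointD adjointN adjoint_id TX M'a.
eexists; apply: is_inverse_adjoint.
apply: (@Rop_inverse _ _ _ _ (adjoint (T \oL Y)) _ M) => //.
- by rewrite ocompA TXT.
- by rewrite -{1}TX -adjoint_comp !ocompA TYT TX.
- by rewrite -{1}TX -adjoint_comp !ocompA TXT.
(* The [M]-symmetry of [T Y] passes to its adjoint with weight [M']: [T Y M' = M' (M T Y) M' = M' (T
   Y)* M M' = M' (T Y)*]. *)
- rewrite adjoint_comp adjointK M'a.
  rewrite -[LHS]ocomp1l -{1}M'M -!ocompA; congr (_ \oL _).
  by rewrite (ocompA T) (ocompA M) -TYM -ocompA MM'1 ocomp1r.
Qed.

Lemma projection_compl H (P : 'L(H)) : P \oL P = P ->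
  (idop H - P) \oL P = 0 /\ P \oL (idop H - P) = 0.
Proof.
by move=> PP; split; rewrite ?ocompDl ?ocompDr ?ocompNl ?ocompNr ?ocomp1l ?ocomp1r
  PP subrr.
Qed.

(* [Q M W], with [W] the inverted operator, equals [Q M Q], which is selfadjoint. *)
Lemma Lop_selfadjoint K (Q M M' L : 'L(K)) : adjoint Q = Q -> Q \oL Q = Q ->
  adjoint M = M -> M \oL M' = idop K ->
  is_inverse (Q + M' \oL (idop K - Q)) L ->
  adjoint (M \oL Q \oL L) = M \oL Q \oL L.
Proof.
move=> Qa QQ Ma MM'; set W := Q + _ => -[_ WL].
have QMW : Q \oL M \oL W = Q \oL M \oL Q.
  rewrite /W ocompDr ocompA -(ocompA Q M M') MM' ocomp1r.
  by rewrite (projection_compl QQ).2 addr0.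
have WMQ : adjoint W \oL M \oL Q = Q \oL M \oL W.
  have := congr1 (@adjoint R A K K) QMW; rewrite !adjoint_comp Ma Qa => e.
  by rewrite -ocompA e QMW ocompA.
have LW : adjoint L \oL adjoint W = idop K by rewrite -adjoint_comp WL adjoint_id.
have e : M \oL Q \oL L = adjoint L \oL (Q \oL M).
  have -> : Q \oL M = Q \oL M \oL W \oL L by rewrite -ocompA WL ocomp1r.
  by rewrite -WMQ !ocompA LW ocomp1l.
by rewrite {1}e !adjoint_comp adjointK Ma Qa.
Qed.

(* [W N' P], with [W] the inverted operator, equals [P N' P], which is selfadjoint. *)
Lemma Rop_selfadjoint H (P N N' S : 'L(H)) : adjoint P = P -> P \oL P = P ->
  adjoint N = N -> is_inverse N N' ->
  is_inverse (P + (idop H - P) \oL N) S ->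
  adjoint (N \oL S \oL P) = N \oL S \oL P.
Proof.
move=> Pa PP Na NN; have N'a := is_inverse_sa Na NN.
have [ZP _] := projection_compl PP.
case: NN => N'N NN'; set Z := idop H - P in ZP *; clearbody Z.
set W := P + _ => -[SW _].
have WNP : W \oL N' \oL P = P \oL N' \oL P.
  rewrite /W !ocompDl -(ocompA _ N N') NN' ocomp1r.
  by rewrite ZP addr0.
have PNW : P \oL N' \oL adjoint W = W \oL N' \oL P.
  have := congr1 (@adjoint R A H H) WNP; rewrite !adjoint_comp N'a Pa => e.
  by rewrite -ocompA e WNP ocompA.
have WS' : adjoint W \oL adjoint S = idop H by rewrite -adjoint_comp SW adjoint_id.
have e : N \oL S \oL P = P \oL adjoint S \oL N.
  have -> : N \oL S \oL P = N \oL S \oL (P \oL N' \oL adjoint W) \oL adjoint S \oL N.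
    rewrite !ocompA -(ocompA _ (adjoint W)) WS' ocomp1r -(ocompA _ N' N) N'N.
    by rewrite ocomp1r.
  by rewrite PNW !ocompA -(ocompA N S W) SW ocomp1r NN' ocomp1l.
by rewrite {1}e !adjoint_comp adjointK Na Pa ocompA.
Qed.

(** From [T R = T] and [L T = T] the inverses satisfy [T R^-1 = T] and [L^-1 T = T]. With
    [X = mp T], the products of the candidate with [T] are thus [T X L^-1] and [R^-1 X T], whose
    weighted symmetry is given by [Lop_selfadjoint] and [Rop_selfadjoint]. *)
Lemma is_wmp_of_Rop_Lop H K (M : 'L(K)) (N : 'L(H)) (T : 'L(H, K)) :
  weight M -> weight N -> mp_exists T ->
  invertible (Rop T N) -> invertible (Lop T (opinv M)) ->
  is_wmp M N T (opinv (Rop T N) \oL mp T \oL opinv (Lop T (opinv M))).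
Proof.
move=> [Ma Minv] [Na Ninv] /mpP [TXT XTX TX XT] /opinvP RS /opinvP LS.
have MM' := opinvP Minv; set M' := opinv M in LS *.
have M'a : adjoint M' = M' := is_inverse_sa Ma MM'.
have [M'M MM'1] := MM'.
set X := mp T in TXT XTX TX XT RS LS *.
set S := opinv _ in RS *; set L := opinv _ in LS *.
have TR : T \oL Rop T N = T.
  rewrite /Rop -/X ocompDr !ocompA TXT ocompDr ocompNr ocomp1r ocompA TXT subrr.
  by rewrite ocomp0l addr0.
have LT : Lop T M' \oL T = T.
  rewrite /Lop -/X ocompDl TXT -ocompA ocompDl ocompNl ocomp1l TXT subrr.
  by rewrite ocomp0r addr0.
have TS : T \oL S = T by rewrite -{1}TR -ocompA RS.2 ocomp1r.
have LT' : L \oL T = T by rewrite -{1}LT ocompA LS.1 ocomp1l.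
split.
- by rewrite -!ocompA LT' (ocompA T) TS ocompA TXT.
- by rewrite -!ocompA (ocompA L) LT' (ocompA T) TS !ocompA -(ocompA S) -(ocompA S) XTX.
- have -> : M \oL T \oL (S \oL X \oL L) = M \oL (T \oL X) \oL L.
    by rewrite !ocompA -(ocompA M T S) TS.
  apply: Lop_selfadjoint MM'1 LS => //; by rewrite ocompA TXT.
- have -> : N \oL (S \oL X \oL L) \oL T = N \oL S \oL (X \oL T).
    by rewrite !ocompA -(ocompA _ L T) LT'.
  have [N' NN'] := Ninv.
  apply: Rop_selfadjoint NN' RS => //; by rewrite ocompA XTX.
Qed.

End WeightedInverse.

Theorem theorem2p10 (R : realType) (AA : cstarAlgType R)
    (H K : hilbertModType AA) (M : 'L(K)) (N : 'L(H)) (A : 'L(H, K))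
    (hM : weight M) (hN : weight N) :
  [<-> wmp_exists M N A;
       wmp_exists M (idop H) A /\ wmp_exists (idop K) N A;
       [/\ mp_exists A, invertible (Rop A N) & invertible (Lop A (opinv M))]] /\
  (wmp_exists M N A ->
     wmp M N A = opinv (Rop A N) \oL mp A \oL opinv (Lop A (opinv M))).
Proof.
have i_ii : wmp_exists M N A ->
    wmp_exists M (idop H) A /\ wmp_exists (idop K) N A.
  by move=> MNA; split; [apply: wmp_exists_left MNA | apply: wmp_exists_right MNA].
have ii_iii : wmp_exists M (idop H) A /\ wmp_exists (idop K) N A ->
    [/\ mp_exists A, invertible (Rop A N) & invertible (Lop A (opinv M))].
  move=> [MA NA]; have A_mp := mp_exists_of_weighted MA NA.
  by split; [|apply: invertible_Rop|apply: invertible_Lop].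
split.
  tfae; [exact: i_ii | exact: ii_iii |].
  move=> [A_mp RA LA].
  by exists (opinv (Rop A N) \oL mp A \oL opinv (Lop A (opinv M)));
    apply: is_wmp_of_Rop_Lop.
move=> MNA; have [A_mp RA LA] := ii_iii (i_ii MNA).
apply: (is_wmp_uniq hM hN); last exact: is_wmp_of_Rop_Lop.
by case: MNA => X /(xgetI 0).
Qed.
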